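(* The problem of deciding, given the Cayley tables of two finite Abelian groups, whether they are isomorphic, is in $\beta_1\mathsf{MAC}^0(\mathsf{FOLL})$.
   Context: $\beta_1\mathsf{MAC}^0(\mathsf{FOLL})$ denotes the class of languages decidable by a uniform family of circuits that receive, besides the input, $O(\log n)$ nondeterministic input bits (accepting iff some setting of these bits leads to acceptance), have depth $O(\log\log n)$ and polynomial size, have gates of unbounded fan-in, and in which every gate is an AND, OR or NOT gate except the output gate, which is a single Majority gate of unbounded fan-in (outputting 1 iff strictly more than half its inputs are 1). Equivalently, it is the class of functions $g\circ f$ with $f$ computable in $\mathsf{FOLL}$ (polynomial-size, depth $O(\log\log n)$, unbounded fan-in AND/OR/NOT circuits) and $g$ computable by constant-depth polynomial-size such circuits with $O(\log n)$ nondeterministic bits and one Majority gate. *)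

(* Defs.v *)
From HB Require Import structures.
From mathcomp Require Import all_boot all_fingroup all_algebra.

Set Implicit Arguments.
Unset Strict Implicit.
Unset Printing Implicit Defensive.

Definition bigO (f g : nat -> nat) : Prop :=
  exists c n0 : nat, forall n, n0 <= n -> f n <= c * g n.

Definition log2 (n : nat) : nat := trunc_log 2 n.

(** * Circuits with [n] input bits and [m] nondeterministic bits *)

(* Constants are the [And] and [Or] gates of fan-in 0. *)
Variant gate_kind (n m : nat) : Type :=
  | Input of 'I_n
  | Guess of 'I_m
  | And
  | Or
  | Not
  | Maj.

Arguments Input {n m} _.
Arguments Guess {n m} _.
Arguments And {n m}.
Arguments Or {n m}.
Arguments Not {n m}.
Arguments Maj {n m}.

(* [wire u v]: the value of [u] is an input of [v].  Feeding the same value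
   several times into a gate is done through fan-in-1 [And] copies. *)
Record circuit (n m : nat) : Type := Circuit {
  gate : finType;
  kind : gate -> gate_kind n m;
  wire : rel gate;
  output : gate
}.

Section Circuit.
Variables (n m : nat) (C : circuit n m).

Definition fan_in (v : gate C) : {set gate C} := [set u | wire u v].

Definition acyclic : Prop :=
  forall u v : gate C, wire u v -> ~~ connect (@wire n m C) v u.

Definition arity_ok (v : gate C) : Prop :=
  match kind v with
  | Input _ | Guess _ => #|fan_in v| = 0
  | Not => #|fan_in v| = 1
  | And | Or | Maj => True
  end.

Definition well_formed : Prop := acyclic /\ forall v, arity_ok v.

Definition depth_le (d : nat) : Prop :=
  forall (u : gate C) (p : seq (gate C)), path (@wire n m C) u p -> size p <= d.

Definition circuit_size : nat := #|gate C|.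

(* The output gate is a Majority gate, all other gates are AND, OR, NOT
   gates (or input bits). *)
Definition single_output_majority : Prop :=
  kind (output C) = Maj /\ forall v : gate C, kind v = Maj -> v = output C.

Section Eval.
Variables (x : n.-tuple bool) (w : m.-tuple bool).

Fixpoint gate_value (fuel : nat) (v : gate C) : bool :=
  if fuel is k.+1 then
    match kind v with
    | Input i => tnth x i
    | Guess j => tnth w j
    | And => [forall u in fan_in v, gate_value k u]
    | Or => [exists u in fan_in v, gate_value k u]
    | Not => ~~ [exists u in fan_in v, gate_value k u]
    | Maj => #|fan_in v| < 2 * #|[set u in fan_in v | gate_value k u]|
    end
  else false.

(* A path of an acyclic circuit visits at most [#|gate C|] gates, so the fuel
   is never exhausted. *)
Definition circuit_value : bool := gate_value #|gate C| (output C).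

End Eval.
End Circuit.

(** * First-order uniformity *)

(* First-order logic with the built-in numerical predicates =, <=, +, *, BIT.
   Variables are de Bruijn indices into the environment; on inputs of length
   [n] the quantifiers range over {0, .., n}. *)
Inductive formula : Type :=
  | FEq of nat & nat
  | FLe of nat & nat
  | FAdd of nat & nat & nat
  | FMul of nat & nat & nat
  | FBit of nat & nat
  | FNot of formula
  | FAnd of formula & formula
  | FOr of formula & formula
  | FEx of formula
  | FAll of formula.

Definition bit (i a : nat) : bool := odd (a %/ 2 ^ i).

Fixpoint sat (n : nat) (f : formula) (e : seq nat) : bool :=
  let v := nth 0 e in
  match f with
  | FEq i j => v i == v j
  | FLe i j => v i <= v j
  | FAdd i j k => v i + v j == v k
  | FMul i j k => v i * v j == v k
  | FBit i j => bit (v i) (v j)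
  | FNot f1 => ~~ sat n f1 e
  | FAnd f1 f2 => sat n f1 e && sat n f2 e
  | FOr f1 f2 => sat n f1 e || sat n f2 e
  | FEx f1 => [exists a : 'I_n.+1, sat n f1 (val a :: e)]
  | FAll f1 => [forall a : 'I_n.+1, sat n f1 (val a :: e)]
  end.

Definition values (n k : nat) (t : k.-tuple 'I_n.+1) : seq nat := map val t.

Definition fo_definable (k : nat) (P : nat -> seq nat -> Prop) : Prop :=
  exists f : formula, forall n (t : k.-tuple 'I_n.+1),
    sat n f (values t) <-> P n (values t).

(* FO-uniformity (Barrington, Immerman, Straubing): the gates of the [n]-th
   circuit are addressed by [k]-tuples over {0, .., n}, and the direct
   connection language (gate types and wires) is first-order definable.
   The indices of nondeterministic bits are O(log n), hence are elements of
   {0, .., n} for all but finitely many [n]. *)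
Definition fo_uniform (m : nat -> nat) (C : forall n, circuit n (m n)) : Prop :=
  exists (k : nat) (addr : forall n, gate (C n) -> k.-tuple 'I_n.+1),
    let has_kind (K : forall n, gate_kind n (m n)) n s :=
      exists v : gate (C n), kind v = K n /\ s = values (addr n v) in
    (forall n, injective (addr n)) /\
    fo_definable k (has_kind (fun _ => And)) /\
    fo_definable k (has_kind (fun _ => Or)) /\
    fo_definable k (has_kind (fun _ => Not)) /\
    fo_definable k (has_kind (fun _ => Maj)) /\
    fo_definable (k + 1) (fun n s => exists (v : gate (C n)) (i : 'I_n),
      kind v = Input i /\ s = values (addr n v) ++ [:: val i]) /\
    fo_definable (k + 1) (fun n s => exists (v : gate (C n)) (j : 'I_(m n)),
      kind v = Guess j /\ s = values (addr n v) ++ [:: val j]) /\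
    fo_definable (k + k) (fun n s => exists u v : gate (C n),
      wire u v /\ s = values (addr n u) ++ values (addr n v)) /\
    fo_definable k (fun n s => s = values (addr n (output (C n)))).

(** * The class beta_1 MAC^0(FOLL) *)

Definition language : Type := seq bool -> Prop.

Definition beta1_MAC0_FOLL (L : language) : Prop :=
  exists (m : nat -> nat) (C : forall n, circuit n (m n)),
    bigO m log2 /\
    (forall n, well_formed (C n)) /\
    (forall n, single_output_majority (C n)) /\
    (exists k, bigO (fun n => circuit_size (C n)) (fun n => n ^ k)) /\
    (exists d : nat -> nat, bigO d (fun n => log2 (log2 n)) /\
       forall n, depth_le (C n) (d n)) /\
    fo_uniform C /\
    (forall n (x : n.-tuple bool),
       L x <-> exists w : (m n).-tuple bool, circuit_value (C n) x w).

(** * Isomorphism of Abelian groups given by Cayley tables *)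

Definition is_cayley_table (gT : finGroupType) (n : nat) (T : 'M['I_n]_n) : Prop :=
  exists e : 'I_n -> gT,
    bijective e /\ forall i j, e (T i j) = (e i * e j)%g.

Definition binary (w a : nat) : seq bool := [seq bit i a | i <- iota 0 w].

(* Row by row, every entry written with ceil(log2 n) bits, least significant
   bit first. *)
Definition encode_table (n : nat) (T : 'M['I_n]_n) : seq bool :=
  flatten [seq binary (up_log 2 n) (T i j) | i <- enum 'I_n, j <- enum 'I_n].

(* The unary header 1^n 0 1^m 0 with the two orders makes the encoding of the
   pair of tables injective. *)
Definition encode_pair (n m : nat) (T : 'M['I_n]_n) (U : 'M['I_m]_m) : seq bool :=
  nseq n true ++ false :: nseq m true ++ false :: encode_table T ++ encode_table U.

Definition abelian_group_isomorphism : language := fun x =>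
  exists (gT hT : finGroupType) (n m : nat) (T : 'M['I_n]_n) (U : 'M['I_m]_m),
    [/\ is_cayley_table gT T, is_cayley_table hT U, x = encode_pair T U
      & [/\ abelian [set: gT], abelian [set: hT]
          & [set: gT] \isog [set: hT]]].

(* Main.v *)
(* Let a_d and b_d be the numbers of solutions of z^d = 1 in the two groups G and H.
   These numbers determine the invariant factors, so G and H are isomorphic iff
   sum_d (a_d - b_d)^2 <= 0.  Expanding the square gives a single majority vote over
   (copy, d, u, v): both u in G and v in H are killed by d (two copies), u and v in G
   are not both killed by d, u and v in H are not both killed by d; one extra vote turns
   "at least half" into "more than half".  No nondeterministic bits are needed.
   Powers are computed in depth O(log log n) from g^i = (g^a)^c g^b, where i = ac + b
   and a, b, c are at most the ceiling of the square root of i.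
   Uniformity is obtained by compiling first-order formulas with guarded recursive calls
   into circuits whose gates are pairs (subformula, assignment of the variables). *)
From HB Require Import structures.
From mathcomp Require Import all_boot all_fingroup all_solvable matrix zify.
From Stdlib Require Import FunctionalExtensionality.
Require Import Defs.

Set Implicit Arguments.
Unset Strict Implicit.
Unset Printing Implicit Defensive.

(** * First-order definability of numerical predicates *)

(** Repeated squaring would nest about log n table lookups. Splitting an exponent at its square root
    roughly halves its logarithm per call, so the nesting is only doubly logarithmic; the parts of
    the exponent and the intermediate group elements are guessed by OR gates of unbounded fan-in.
    The whole recursion is not one first-order formula, but a single unfolding of it is, and wires
    only join a call to the body it invokes. Uniformity can therefore be proved once, for an
    arbitrary body. Acyclicity has to hold for every content of the registers, meaningful or not, so
    each call carries a purely numerical guard that does not look at the input. Equality of all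
    torsion counts is a conjunction, yet a single threshold can test it: squares are nonnegative, so
    one bound on their sum forces each of them to vanish. *)

Definition env := nat -> nat.

Definition scons (a : nat) (e : env) : env := fun i => if i is j.+1 then e j else a.

(** With total functions as environments, renaming variables is composition and no list length has
    to be tracked. *)
Fixpoint fsat (n : nat) (f : formula) (e : env) : bool :=
  match f with
  | FEq i j => e i == e j
  | FLe i j => e i <= e j
  | FAdd i j k => e i + e j == e k
  | FMul i j k => e i * e j == e k
  | FBit i j => bit (e i) (e j)
  | FNot f1 => ~~ fsat n f1 e
  | FAnd f1 f2 => fsat n f1 e && fsat n f2 e
  | FOr f1 f2 => fsat n f1 e || fsat n f2 e
  | FEx f1 => [exists a : 'I_n.+1, fsat n f1 (scons a e)]
  | FAll f1 => [forall a : 'I_n.+1, fsat n f1 (scons a e)]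
  end.

Lemma nth_scons a s : nth 0 (a :: s) = scons a (nth 0 s).
Proof. by apply: functional_extensionality => -[]. Qed.

Lemma satE n f s : sat n f s = fsat n f (nth 0 s).
Proof.
elim: f s => //= [f IH|f IHf g IHg|f IHf g IHg|f IH|f IH] s.
- by rewrite IH.
- by rewrite IHf IHg.
- by rewrite IHf IHg.
- by apply: eq_existsb => a; rewrite IH nth_scons.
- by apply: eq_forallb => a; rewrite IH nth_scons.
Qed.

Definition bounded (n : nat) (e : env) := forall i, e i <= n.

(** Data rather than an existential statement: formulas are assembled by combinators and later
    become gates. Correctness is asked only for values inside the universe, since addresses and
    quantifiers produce no others. *)
Record defn (P : nat -> env -> bool) : Type := Defn {
  fm : formula;
  fmP : forall n e, bounded n e -> fsat n fm e = P n e
}.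

Lemma defn_ext P Q : (forall n e, bounded n e -> P n e = Q n e) -> defn P -> defn Q.
Proof. by move=> PQ [f fP]; exists f => n e be; rewrite fP ?PQ. Qed.

Lemma bounded_scons n a e : a <= n -> bounded n e -> bounded n (scons a e).
Proof. by move=> an be []. Qed.

(** * Renaming of variables and closure under connectives *)

Definition lift_ren (r : nat -> nat) i := if i is j.+1 then (r j).+1 else 0.

Fixpoint rename (r : nat -> nat) (f : formula) : formula :=
  match f with
  | FEq i j => FEq (r i) (r j)
  | FLe i j => FLe (r i) (r j)
  | FAdd i j k => FAdd (r i) (r j) (r k)
  | FMul i j k => FMul (r i) (r j) (r k)
  | FBit i j => FBit (r i) (r j)
  | FNot f1 => FNot (rename r f1)
  | FAnd f1 f2 => FAnd (rename r f1) (rename r f2)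
  | FOr f1 f2 => FOr (rename r f1) (rename r f2)
  | FEx f1 => FEx (rename (lift_ren r) f1)
  | FAll f1 => FAll (rename (lift_ren r) f1)
  end.

Lemma fsat_rename n f r e : fsat n (rename r f) e = fsat n f (e \o r).
Proof.
have sc a r' e' : scons a e' \o lift_ren r' = scons a (e' \o r').
  by apply: functional_extensionality => -[].
elim: f r e => //= [f IH|f IHf g IHg|f IHf g IHg|f IH|f IH] r e.
- by rewrite IH.
- by rewrite IHf IHg.
- by rewrite IHf IHg.
- by apply: eq_existsb => a; rewrite IH sc.
- by apply: eq_forallb => a; rewrite IH sc.
Qed.

Lemma defn_ren P r : defn P -> defn (fun n e => P n (fun i => e (r i))).
Proof.
by move=> [f fP]; exists (rename r f) => n e be; rewrite fsat_rename fP // => i; exact: be.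
Qed.

Lemma defn_eq i j : defn (fun _ e => e i == e j).
Proof. by exists (FEq i j). Qed.

Lemma defn_le i j : defn (fun _ e => e i <= e j).
Proof. by exists (FLe i j). Qed.

Lemma defn_add i j k : defn (fun _ e => e i + e j == e k).
Proof. by exists (FAdd i j k). Qed.

Lemma defn_mul i j k : defn (fun _ e => e i * e j == e k).
Proof. by exists (FMul i j k). Qed.

Lemma defn_bit i j : defn (fun _ e => bit (e i) (e j)).
Proof. by exists (FBit i j). Qed.

Lemma defn_not P : defn P -> defn (fun n e => ~~ P n e).
Proof. by case=> f fP; exists (FNot f) => n e be /=; rewrite fP. Qed.

Lemma defn_and P Q : defn P -> defn Q -> defn (fun n e => P n e && Q n e).
Proof. by move=> [f fP] [g gP]; exists (FAnd f g) => n e be /=; rewrite fP ?gP. Qed.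

Lemma defn_or P Q : defn P -> defn Q -> defn (fun n e => P n e || Q n e).
Proof. by move=> [f fP] [g gP]; exists (FOr f g) => n e be /=; rewrite fP ?gP. Qed.

Lemma defn_imp P Q : defn P -> defn Q -> defn (fun n e => P n e ==> Q n e).
Proof.
move=> DP DQ; apply: defn_ext (defn_or (defn_not DP) DQ) => n e _.
by rewrite implybE.
Qed.

Lemma defn_ex (P : nat -> nat -> env -> bool) :
  defn (fun n e => P n (e 0) (fun i => e i.+1)) ->
  defn (fun n e => [exists a : 'I_n.+1, P n a e]).
Proof.
move=> [f fP]; exists (FEx f) => n e be /=; apply: eq_existsb => a.
by rewrite fP //; apply: bounded_scons => //; rewrite -ltnS.
Qed.

Lemma defn_all (P : nat -> nat -> env -> bool) :
  defn (fun n e => P n (e 0) (fun i => e i.+1)) ->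
  defn (fun n e => [forall a : 'I_n.+1, P n a e]).
Proof.
move=> [f fP]; exists (FAll f) => n e be /=; apply: eq_forallb => a.
by rewrite fP //; apply: bounded_scons => //; rewrite -ltnS.
Qed.

Lemma defn_lt i j : defn (fun _ e => e i < e j).
Proof. by apply: defn_ext (defn_not (defn_le j i)) => n e _; rewrite -ltnNge. Qed.

Lemma defn_true : defn (fun _ _ => true).
Proof. by apply: defn_ext (defn_eq 0 0) => n e _; rewrite eqxx. Qed.

Lemma defn_false : defn (fun _ _ => false).
Proof. exact: defn_ext (defn_not defn_true). Qed.

Lemma defn_const (b : bool) : defn (fun _ _ => b).
Proof. by case: b; [exact: defn_true | exact: defn_false]. Qed.

Lemma defn_seq_all (T : Type) (s : seq T) (P : T -> nat -> env -> bool) :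
  (forall x, defn (P x)) -> defn (fun n e => all (fun x => P x n e) s).
Proof.
by move=> DP; elim: s => [|x s IH] /=; [exact: defn_true | exact: defn_and].
Qed.

Lemma defn_seq_has (T : Type) (s : seq T) (P : T -> nat -> env -> bool) :
  (forall x, defn (P x)) -> defn (fun n e => has (fun x => P x n e) s).
Proof.
by move=> DP; elim: s => [|x s IH] /=; [exact: defn_false | exact: defn_or].
Qed.

(* Values of [t] outside {0, .., n} are allowed: only its graph restricted to the
   universe has to be definable.  Subterms of a sum are bounded by the sum, and those
   of a nonzero product by the product, so arithmetic terms compose. *)
Definition tdef (t : nat -> env -> nat) : Type :=
  defn (fun n e => e 0 == t n (fun i => e i.+1)).

Lemma exists_ordE n (P : nat -> bool) t :
  (forall a, a <= n -> P a -> a = t) -> [exists a : 'I_n.+1, P a] = (t <= n) && P t.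
Proof.
move=> Pt; apply/existsP/andP => [[a Pa]|[tn Pt']].
  have an : a <= n by rewrite -ltnS.
  by rewrite -(Pt a an Pa).
by rewrite -ltnS in tn; exists (Ordinal tn).
Qed.

Lemma tdef_var i : tdef (fun _ e => e i).
Proof. exact: defn_eq. Qed.

(** One-point rule: a term is substituted into a predicate by quantifying over its value, at the
    price of the condition that this value lies in the universe. *)
Lemma defn_exists_eq P t :
  defn (fun n e => P n (e 0) (fun i => e i.+1)) -> tdef t ->
  defn (fun n e => (t n e <= n) && P n (t n e) e).
Proof.
move=> DP Dt.
apply: (defn_ext _ (@defn_ex (fun n a e => (a == t n e) && P n a e) (defn_and Dt DP))).
move=> n e be; rewrite (@exists_ordE _ (fun a => (a == t n e) && P n a e) (t n e)).
  by rewrite eqxx.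
by move=> a _ /andP[/eqP].
Qed.

(** A term bounded by [e i] lies in the universe, so the side condition of the one-point rule
    disappears. The reversed comparisons follow by negation, and then the term may exceed [n]. *)
Lemma defn_tle t i : tdef t -> defn (fun n e => t n e <= e i).
Proof.
move=> Dt; apply: defn_ext
  (@defn_exists_eq (fun n a e => a <= e i) t (defn_le 0 i.+1) Dt) => n e be.
by have := be i; lia.
Qed.

Lemma defn_tlt t i : tdef t -> defn (fun n e => t n e < e i).
Proof.
move=> Dt; apply: defn_ext
  (@defn_exists_eq (fun n a e => a < e i) t (defn_lt 0 i.+1) Dt) => n e be.
by have := be i; lia.
Qed.

Lemma defn_vle t i : tdef t -> defn (fun n e => e i <= t n e).
Proof.
by move=> /(defn_tlt i)/defn_not; apply: defn_ext => n e _; rewrite -leqNgt.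
Qed.

Lemma defn_vlt t i : tdef t -> defn (fun n e => e i < t n e).
Proof.
by move=> /(defn_tle i)/defn_not; apply: defn_ext => n e _; rewrite -ltnNge.
Qed.

Lemma defn_veq t i : tdef t -> defn (fun n e => e i == t n e).
Proof.
move=> Dt; apply: defn_ext (defn_and (defn_tle i Dt) (defn_vle i Dt)) => n e _.
by rewrite eqn_leq andbC.
Qed.

Lemma tdef_shift t : tdef t -> tdef (fun n e => t n (fun i => e i.+1)).
Proof.
by move=> /(defn_ren (fun i => if i is j.+1 then j.+2 else 0)).
Qed.

Lemma tdef_add t1 t2 : tdef t1 -> tdef t2 -> tdef (fun n e => t1 n e + t2 n e).
Proof.
move=> D1 D2.
have DP : defn (fun n (e : env) =>
    (t2 n (fun i => e i.+2) <= n) && (e 0 + t2 n (fun i => e i.+2) == e 1)).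
  have := @defn_exists_eq (fun n b e => e 0 + b == e 1)
           (fun n e => t2 n (fun i => e i.+2)) (defn_add 1 0 2).
  by apply; exact: (tdef_shift (tdef_shift D2)).
have := @defn_exists_eq (fun n a e => (t2 n (fun i => e i.+1) <= n) &&
   (a + t2 n (fun i => e i.+1) == e 0))
   (fun n e => t1 n (fun i => e i.+1)) DP (tdef_shift D1).
apply: defn_ext => n e be; have := be 0.
set a := t1 _ _; set b := t2 _ _.
by case: (leqP a n) => //= ; case: (leqP b n) => //=; lia.
Qed.

(** Zero is the solution of [a + a = a], one is the other solution of [a * a = a], and larger
    constants are sums. *)
Lemma defn_const_eq c i : defn (fun _ e => e i == c).
Proof.
suff D0 : defn (fun _ e => e 0 == c) by exact: (defn_ren (fun _ => i) D0).
elim: c => [|c IH].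
  by apply: defn_ext (defn_add 0 0 0) => n e _; lia.
have D1 : defn (fun _ e => e 0 == 1).
  apply: defn_ext (defn_and (defn_mul 0 0 0) (defn_not (defn_add 0 0 0))) => n e _.
  by case: (e 0) => [|[|k]] //=; nia.
have : tdef (fun _ _ => c + 1).
  by apply: (@tdef_add (fun _ _ => c) (fun _ _ => 1)).
by apply: defn_ext => n e _; rewrite addn1.
Qed.

Lemma tdef_const c : tdef (fun _ _ => c).
Proof. exact: defn_const_eq. Qed.

Lemma tdef_mul t1 t2 : tdef t1 -> tdef t2 -> tdef (fun n e => t1 n e * t2 n e).
Proof.
move=> D1 D2.
have DP : defn (fun n (e : env) =>
    (t2 n (fun i => e i.+2) <= n) && (e 0 * t2 n (fun i => e i.+2) == e 1)).
  have := @defn_exists_eq (fun n b e => e 0 * b == e 1)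
           (fun n e => t2 n (fun i => e i.+2)) (defn_mul 1 0 2).
  by apply; exact: (tdef_shift (tdef_shift D2)).
have DQ := @defn_exists_eq (fun n a e => (t2 n (fun i => e i.+1) <= n) &&
   (a * t2 n (fun i => e i.+1) == e 0))
   (fun n e => t1 n (fun i => e i.+1)) DP (tdef_shift D1).
(* A zero product may have a factor outside the universe, where the one-point rule is silent; here
   it suffices to ask that one factor be at most 0. *)
have DZ : defn (fun n e => (e 0 == 0) &&
   ((t1 n (fun i => e i.+1) <= e 0) || (t2 n (fun i => e i.+1) <= e 0))).
  apply: defn_and (defn_const_eq 0 0) (defn_or _ _).
    exact: (defn_tle 0 (tdef_shift D1)).
  exact: (defn_tle 0 (tdef_shift D2)).
apply: defn_ext (defn_or DQ DZ) => n e be; have := be 0.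
set a := t1 _ _; set b := t2 _ _; set c := e 0 => cn.
case: (posnP c) => [->|c0].
  by rewrite !leqn0 !(eq_sym 0) !muln_eq0 /=; case: (a =P 0); case: (b =P 0); rewrite ?andbF ?orbT.
rewrite /= orbF [RHS]eq_sym.
case: eqP => [abc|]; rewrite ?andbF //= !andbT.
by move: c0 cn; rewrite -abc muln_gt0 => /andP[a0 b0] abn; apply/andP; split; nia.
Qed.

Lemma defn_top i : defn (fun n e => e i == n).
Proof.
apply: (defn_ext _ (@defn_all (fun _ a e => a <= e i) (defn_le 0 i.+1))).
move=> n e be; apply/forallP/eqP => [/(_ ord_max) /= ni|-> a].
  by apply/eqP; rewrite eqn_leq ni be.
by rewrite -ltnS.
Qed.

Lemma defn_eq_top t : tdef t -> defn (fun n e => n == t n e).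
Proof.
move=> Dt; apply: defn_ext
  (@defn_exists_eq (fun n a e => a == n) t (defn_top 0) Dt) => n e _.
by lia.
Qed.

(** * The binary logarithm as a first-order predicate *)

Lemma tdef_pred i : tdef (fun _ e => (e i).-1).
Proof.
have Dz : defn (fun _ e => (e i.+1 == 0) && (e 0 == 0)).
  exact: defn_and (defn_const_eq 0 _) (defn_const_eq 0 0).
have Ds : defn (fun _ e => e i.+1 == e 0 + 1).
  exact: (@defn_veq (fun _ e => e 0 + 1) i.+1 (tdef_add (tdef_var 0) (tdef_const 1))).
by apply: defn_ext (defn_or Dz Ds) => n e _; lia.
Qed.

(** Exponentiation is missing from the vocabulary, but BIT detects it: [a] reaches [2 ^ L] exactly
    when it has a bit at position [L] or above. Its top bit sits at [trunc_log 2 a], which is at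
    most [a] and hence in the universe. *)
Lemma ltn_expn_bit n a L : a <= n ->
  (a < 2 ^ L) = [forall i : 'I_n.+1, (L <= i) ==> ~~ bit i a].
Proof.
move=> an; apply/idP/forallP => [aL i|H].
  apply/implyP => Li; rewrite /bit divn_small //.
  by apply: leq_trans aL _; rewrite leq_exp2l.
rewrite ltnNge; apply/negP => La.
have a0 : 0 < a by apply: leq_trans La; rewrite expn_gt0.
have /andP[l1 l2] := trunc_log_bounds (isT : 1 < 2) a0.
set l := trunc_log 2 a in l1 l2.
have ln : l < n.+1.
  by rewrite ltnS; apply: leq_trans an; apply: leq_trans l1; rewrite ltnW // ltn_expl.
have Ll : L <= l.
  rewrite leqNgt; apply/negP => lL.
  by move: (leq_trans l2 (leq_trans (leq_pexp2l (isT : 0 < 2) lL) La)); rewrite ltnn.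
have := H (Ordinal ln); rewrite /= Ll /bit.
suff -> : a %/ 2 ^ l = 1 by [].
apply/eqP; rewrite eqn_leq -ltnS ltn_divLR ?expn_gt0 // -expnS l2.
by rewrite leq_divRL ?expn_gt0 // mul1n.
Qed.

(** The logarithm is the least exponent [b] with [a <= 2 ^ b]; for positive [a] this is the strict
    bound on [a.-1] that the bit test expresses. *)
Lemma defn_up_log i j : defn (fun _ e => (0 < e i) && (e j == up_log 2 (e i))).
Proof.
have DA k l : defn (fun n e =>
    [forall b : 'I_n.+1, (e k <= b) ==> ~~ [exists a : 'I_n.+1,
       (a == (e l).-1 :> nat) && bit b a]]).
  apply: (@defn_all (fun n b e => (e k <= b) ==> ~~ [exists a : 'I_n.+1,
       (a == (e l).-1 :> nat) && bit b a])).
  apply: defn_imp (defn_le k.+1 0) _; apply: defn_not.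
  apply: (@defn_ex (fun n a e => (a == (e l.+1).-1) && bit (e 0) a)).
  by apply: defn_and (defn_bit 1 0); exact: (tdef_pred l.+1).
have DB k l : defn (fun n e => (e l).-1 < 2 ^ e k).
  apply: defn_ext (DA k l) => n e be.
  have bl : (e l).-1 <= n by apply: leq_trans (be l); exact: leq_pred.
  rewrite (ltn_expn_bit _ bl); apply: eq_forallb => b; congr (_ ==> ~~ _).
  rewrite (@exists_ordE _ (fun a => (a == (e l).-1) && bit b a) (e l).-1) ?eqxx ?bl //.
  by move=> a _ /andP[/eqP].
have DC : defn (fun n e => [forall a : 'I_n.+1, (a < e j) ==> ~~ ((e i).-1 < 2 ^ a)]).
  apply: (@defn_all (fun n a e => (a < e j) ==> ~~ ((e i).-1 < 2 ^ a))).
  exact: defn_imp (defn_lt 0 j.+1) (defn_not (DB 0 i.+1)).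
apply: defn_ext (defn_and (defn_tlt i (tdef_const 0)) (defn_and (DB j i) DC)) => n e be.
case: (posnP (e i)) => [->//|i0] /=; rewrite prednK //.
apply/andP/eqP => [[le_i /forallP H]|->].
  apply/eqP; rewrite eqn_leq up_log_min // andbT leqNgt; apply/negP => lt_u.
  have un : up_log 2 (e i) < n.+1 by rewrite ltnS (leq_trans (ltnW lt_u)).
  have /implyP /(_ lt_u) /negP[] := H (Ordinal un).
  by rewrite /= up_logP.
split; first by rewrite up_logP.
apply/forallP => a; apply/implyP => lt_a; apply/negP => H.
by move: (up_log_min (isT : 1 < 2) H); rewrite leqNgt lt_a.
Qed.

(** * Evaluation and depth of acyclic circuits *)

Section CircuitFacts.
Variables (n m : nat) (C : circuit n m).

Definition value (x : n.-tuple bool) (w : m.-tuple bool) (v : gate C) : bool :=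
  gate_value x w #|gate C| v.

Definition ancestors (v : gate C) : {set gate C} := [set u | connect (@wire n m C) u v].

Lemma ancestors_proper u v : acyclic C -> wire u v -> #|ancestors u| < #|ancestors v|.
Proof.
move=> ac uv; apply: proper_card; apply/properP; split.
  apply/subsetP => t; rewrite !inE => tu.
  exact: connect_trans tu (connect1 uv).
by exists v; rewrite !inE ?connect0 // ac.
Qed.

(** The number of ancestors strictly drops along a wire read backwards, so it is always enough
    fuel. *)
Lemma gate_value_stable x w : acyclic C -> forall k k' v,
  #|ancestors v| <= k -> #|ancestors v| <= k' ->
  gate_value x w k v = gate_value x w k' v.
Proof.
move=> ac; have pos v : 0 < #|ancestors v|.
  by apply/card_gt0P; exists v; rewrite inE connect0.
elim=> [|k IH] [|k'] v vk vk' //; try by have := pos v; lia.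
have eqk u : u \in fan_in v -> gate_value x w k u = gate_value x w k' u.
  by rewrite inE => /(ancestors_proper ac) uv; apply: IH; lia.
rewrite /=; case: (kind v) => //.
- by apply: eq_forallb_in.
- by apply: eq_existsb_in.
- by congr (~~ _); apply: eq_existsb_in.
by congr (_ < 2 * _); apply: eq_card => u; rewrite !inE; case uv: (wire u v);
  rewrite //= eqk // inE.
Qed.

Lemma valueE x w v : acyclic C -> value x w v =
  match kind v with
  | Input i => tnth x i
  | Guess j => tnth w j
  | And => [forall u in fan_in v, value x w u]
  | Or => [exists u in fan_in v, value x w u]
  | Not => ~~ [exists u in fan_in v, value x w u]
  | Maj => #|fan_in v| < 2 * #|[set u in fan_in v | value x w u]|
  end.
Proof.
move=> ac; rewrite /value.
by rewrite (@gate_value_stable x w ac _ #|gate C|.+1) ?max_card // ltnW // ltnS max_card.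
Qed.

Variable lev : gate C -> nat.
Hypothesis lev_wire : forall u v, wire u v -> lev u < lev v.

(** A level that grows along wires bounds path lengths and excludes cycles, so one function yields
    both depth and acyclicity. *)
Lemma lev_path u p : path (@wire n m C) u p -> lev u + size p <= lev (last u p).
Proof.
elim: p u => [|v p IH] u /=; first by rewrite addn0.
case/andP=> /lev_wire uv /IH; apply: leq_trans.
by rewrite addnS -addSn leq_add2r.
Qed.

Lemma lev_acyclic : acyclic C.
Proof.
move=> u v /lev_wire uv; apply/negP => /connectP[p /lev_path vp defu].
by move: (leq_trans uv (leq_trans (leq_addr _ _) vp)); rewrite -defu ltnn.
Qed.

Lemma lev_depth d : (forall v, lev v <= d) -> depth_le C d.
Proof.
move=> le_d u p /lev_path pu.
exact: leq_trans (leq_addl _ _) (leq_trans pu (le_d _)).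
Qed.

End CircuitFacts.

(** * First-order formulas with input bits and a recursive predicate *)

(* Variables are named registers.  [XRec s] calls the recursive predicate on the
   registers permuted by [s]; the call is made only under [guard]. *)
Inductive xform : Type :=
  | XIn of nat
  | XNum of formula
  | XRec of seq nat
  | XNot of xform
  | XAnd of xform & xform
  | XOr of xform & xform
  | XEx of nat & xform
  | XAll of nat & xform.

Lemma formula_eq_dec (f g : formula) : {f = g} + {f <> g}.
Proof. decide equality; decide equality. Qed.

Lemma xform_eq_dec (f g : xform) : {f = g} + {f <> g}.
Proof.
decide equality; try (by decide equality); first exact: formula_eq_dec.
by decide equality; decide equality.
Qed.

HB.instance Definition _ := hasDecEq.Build xform (compareP xform_eq_dec).

Definition upd (e : env) (j a : nat) : env := fun i => if i == j then a else e i.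

(* Register 0 holds the rank of a call: it drops to (at most) the ceiling of its
   square root, so that calls nest only O(log log n) deep. *)
Definition guard (i j : nat) : bool := (2 < i) && (j.-1 * j.-1 < i).

(** Registers past the end of [s] default to themselves, so a call passes unlisted parameters on
    unchanged. *)
Definition call_env (s : seq nat) (e : env) : env := fun r => e (nth r s r).

Fixpoint xsat (n : nat) (x : seq bool) (R : env -> bool) (f : xform) (e : env) : bool :=
  match f with
  | XIn j => nth false x (e j)
  | XNum g => fsat n g e
  | XRec s => guard (e 0) (call_env s e 0) && R (call_env s e)
  | XNot f1 => ~~ xsat n x R f1 e
  | XAnd f1 f2 => xsat n x R f1 e && xsat n x R f2 e
  | XOr f1 f2 => xsat n x R f1 e || xsat n x R f2 e
  | XEx j f1 => [exists a : 'I_n.+1, xsat n x R f1 (upd e j a)]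
  | XAll j f1 => [forall a : 'I_n.+1, xsat n x R f1 (upd e j a)]
  end.

(** Register 0 is never quantified: between two calls it keeps the rank from which levels are
    computed. *)
Fixpoint regs_ok (K : nat) (f : xform) : bool :=
  match f with
  | XIn _ | XNum _ | XRec _ => true
  | XNot f1 => regs_ok K f1
  | XAnd f1 f2 | XOr f1 f2 => regs_ok K f1 && regs_ok K f2
  | XEx j f1 | XAll j f1 => (0 < j < K) && regs_ok K f1
  end.

Fixpoint height (f : xform) : nat :=
  match f with
  | XIn _ | XNum _ | XRec _ => 0
  | XNot f1 | XEx _ f1 | XAll _ f1 => (height f1).+1
  | XAnd f1 f2 | XOr f1 f2 => (maxn (height f1) (height f2)).+1
  end.

Fixpoint subforms (f : xform) : seq xform :=
  f :: match f with
       | XIn _ | XNum _ | XRec _ => [::]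
       | XNot f1 | XEx _ f1 | XAll _ f1 => subforms f1
       | XAnd f1 f2 | XOr f1 f2 => subforms f1 ++ subforms f2
       end.

Definition children (f : xform) : seq xform :=
  match f with
  | XIn _ | XNum _ | XRec _ => [::]
  | XNot f1 | XEx _ f1 | XAll _ f1 => [:: f1]
  | XAnd f1 f2 | XOr f1 f2 => [:: f1; f2]
  end.

Lemma subforms_refl f : f \in subforms f.
Proof. by case: f => *; rewrite /= in_cons eqxx. Qed.

Lemma subforms_children f g h :
  g \in subforms f -> h \in children g -> h \in subforms f.
Proof.
elim: f => [i|a|s|f IH|f1 IH1 f2 IH2|f1 IH1 f2 IH2|j f IH|j f IH] //=;
  rewrite in_cons ?mem_cat => /predU1P[-> /=|]; rewrite ?inE //.
- by move/eqP->; rewrite subforms_refl orbT.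
- by move=> gf hg; rewrite (IH gf hg) orbT.
- by rewrite mem_cat; case/orP => /eqP->; rewrite subforms_refl ?orbT.
- by rewrite mem_cat; case/orP => gf hg; rewrite ?(IH1 gf hg) ?(IH2 gf hg) ?orbT.
- by rewrite mem_cat; case/orP => /eqP->; rewrite subforms_refl ?orbT.
- by rewrite mem_cat; case/orP => gf hg; rewrite ?(IH1 gf hg) ?(IH2 gf hg) ?orbT.
- by move/eqP->; rewrite subforms_refl orbT.
- by move=> gf hg; rewrite (IH gf hg) orbT.
- by move/eqP->; rewrite subforms_refl orbT.
- by move=> gf hg; rewrite (IH gf hg) orbT.
Qed.

Lemma height_children f g : g \in children f -> height g < height f.
Proof.
case: f => [i|a|s|f|f1 f2|f1 f2|j f|j f] //=; rewrite !inE.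
- by move/eqP->.
- by case/orP => /eqP->; rewrite ltnS ?leq_maxl ?leq_maxr.
- by case/orP => /eqP->; rewrite ltnS ?leq_maxl ?leq_maxr.
- by move/eqP->.
- by move/eqP->.
Qed.

Lemma height_subforms f g : g \in subforms f -> height g <= height f.
Proof.
elim: f => [i|a|s|f IH|f1 IH1 f2 IH2|f1 IH1 f2 IH2|j f IH|j f IH] //=;
  rewrite in_cons ?mem_cat => /predU1P[-> //|] //.
- by move/IH/leqW.
- by case/orP => [/IH1|/IH2] h; apply/leqW/(leq_trans h); rewrite ?leq_maxl ?leq_maxr.
- by case/orP => [/IH1|/IH2] h; apply/leqW/(leq_trans h); rewrite ?leq_maxl ?leq_maxr.
- by move/IH/leqW.
- by move/IH/leqW.
Qed.

Lemma regs_ok_subforms K f g : regs_ok K f -> g \in subforms f -> regs_ok K g.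
Proof.
elim: f => [i|a|s|f IH|f1 IH1 f2 IH2|f1 IH1 f2 IH2|j f IH|j f IH] /= ok;
  rewrite in_cons ?mem_cat => /predU1P[-> //|] //; auto.
- by case/andP: ok => ok1 ok2 /orP[]; auto.
- by case/andP: ok => ok1 ok2 /orP[]; auto.
- by case/andP: ok => _ ok; auto.
- by case/andP: ok => _ ok; auto.
Qed.

(** * The iterated logarithm as a measure of calls *)

Definition rank (i : nat) : nat := up_log 2 (up_log 2 i).

Lemma rank_leq i j : i <= j -> rank i <= rank j.
Proof. by move=> ij; apply/leq_up_log/leq_up_log. Qed.

(** With [r = rank i] and [M = 2 ^ (2 ^ r.-1)] one has [i <= M * M], so the guard forces [j <= M],
    whose rank is [r.-1]. The bound [2 < i] in the guard makes [r] positive. *)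
Lemma rank_guard i j : guard i j -> rank j < rank i.
Proof.
case/andP=> i2 ji; rewrite /rank; set r := up_log 2 (up_log 2 i).
have r0 : 0 < r.
  rewrite up_log_gt0 /= ltnNge; apply/negP => /(leq_pexp2l (isT : 0 < 2)) li.
  by have := leq_trans (up_logP i (isT : 1 < 2)) li; rewrite leqNgt i2.
have ir : i <= 2 ^ (2 ^ r.-1) * 2 ^ (2 ^ r.-1).
  rewrite -expnD addnn -mul2n -expnS prednK //.
  apply: leq_trans (up_logP i (isT : 1 < 2)) _.
  by rewrite leq_exp2l // up_logP.
rewrite -(prednK r0) ltnS; apply: up_log_min => //; apply: up_log_min => //.
move: (2 ^ 2 ^ r.-1) ir => M ir {r r0}.
have jM : j.-1 < M by rewrite ltnNge; apply/negP => le; move: (leq_mul le le); lia.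
by lia.
Qed.

(** * Compiling a recursion under a majority quantifier into circuits *)

Section Compile.
Variables (psi theta : xform) (K : nat).
Variable (dom : nat -> env -> bool).
Hypotheses (K_gt0 : 0 < K) (psi_ok : regs_ok K psi) (theta_ok : regs_ok K theta).
Variable (Ddom : defn dom).

Definition nodes : seq xform := undup (subforms psi ++ subforms theta).
Definition ntags : nat := size nodes.
Definition alen : nat := ntags + K.

(* A gate is an address: [ntags] coordinates hold a one-hot subformula tag (so that
   addresses exist as soon as the universe has two elements), the other [K] the
   registers.  The null address is the output; other untagged addresses are idle. *)
Definition istag (t : nat) (s : env) : bool :=
  all (fun i => s i == (i == t)) (iota 0 ntags).
Definition iszero (s : env) : bool := all (fun i => s i == 0) (iota 0 alen).
(** A numerical subformula may mention any variable, but a gate stores only [K] registers;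
    out-of-range indices are redirected to register 0. *)
Definition regs (s : env) : env := fun r => s (ntags + (if r < K then r else 0)).
Definition normal (e : env) : env := fun r => e (if r < K then r else 0).
Definition tag (f : xform) : nat := index f nodes.
Definition tagof (s : env) : option xform :=
  ohead [seq f <- nodes | istag (tag f) s].

Definition step (f g : xform) (ev eu : env) : bool :=
  match f with
  | XIn _ | XNum _ => false
  | XRec s => [&& g == psi, all (fun r => eu r == call_env s ev r) (iota 0 K)
                & guard (ev 0) (eu 0)]
  | XNot _ | XAnd _ _ | XOr _ _ =>
      (g \in children f) && all (fun r => eu r == ev r) (iota 0 K)
  | XEx j _ | XAll j _ =>
      (g \in children f) && all (fun r => (r == j) || (eu r == ev r)) (iota 0 K)
  end.

Definition wireb (n : nat) (su sv : env) : bool :=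
  [&& iszero sv, istag (tag theta) su & dom n (regs su)] ||
  has (fun f => has (fun g => [&& istag (tag f) sv, istag (tag g) su
                                & step f g (regs sv) (regs su)]) nodes) nodes.

(** Numerical formulas do not see the input, so they become constants, that is AND and OR gates
    without wires. An input position out of range becomes the constant false, the default of [nth].
    A call is an OR with one wire, or with none if its guard fails. *)
Definition kindf (n : nat) (f : xform) (e : env) : gate_kind n 0 :=
  match f with
  | XIn j => if insub (e j) is Some i then Input i else Or
  | XNum g => if fsat n g e then And else Or
  | XNot _ => Not
  | XAnd _ _ | XAll _ _ => And
  | XRec _ | XOr _ _ | XEx _ _ => Or
  end.

Definition kindb (n : nat) (s : env) : gate_kind n 0 :=
  if iszero s then Maj else if tagof s is Some f then kindf n f (regs s) else And.

Definition aval (n : nat) (v : alen.-tuple 'I_n.+1) : env := nth 0 (values v).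

(** All tuples are gates, idle ones included: the address map is the identity, and the connection
    language needs no test for legitimate addresses. *)
Definition rec_circuit (n : nat) : circuit n 0 :=
  @Circuit n 0 (alen.-tuple 'I_n.+1) (fun v => kindb n (aval v))
    (fun u v => wireb n (aval u) (aval v)) [tuple ord0 | i < alen].

Lemma psi_nodes : psi \in nodes.
Proof. by rewrite mem_undup mem_cat subforms_refl. Qed.

Lemma theta_nodes : theta \in nodes.
Proof. by rewrite mem_undup mem_cat subforms_refl orbT. Qed.

Lemma children_nodes f g : f \in nodes -> g \in children f -> g \in nodes.
Proof.
rewrite !mem_undup !mem_cat => /orP[] fn gf.
  by rewrite (subforms_children fn gf).
by rewrite (subforms_children fn gf) orbT.
Qed.

Lemma regs_ok_nodes f : f \in nodes -> regs_ok K f.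
Proof.
by rewrite mem_undup mem_cat => /orP[]; [exact: regs_ok_subforms|exact: regs_ok_subforms].
Qed.

Lemma tag_lt f : f \in nodes -> tag f < ntags.
Proof. by rewrite /ntags index_mem. Qed.

Lemma istagP t (s : env) : reflect (forall i, i < ntags -> s i = (i == t)) (istag t s).
Proof.
apply: (iffP allP) => [H i it|H i].
  by apply/eqP; apply: H; rewrite mem_iota.
by rewrite mem_iota add0n => /= it; apply/eqP/H.
Qed.

Lemma istag_inj f g s : f \in nodes -> g \in nodes ->
  istag (tag f) s -> istag (tag g) s -> f = g.
Proof.
move=> fn gn /istagP sf /istagP sg; have := sf _ (tag_lt fn); rewrite sg ?tag_lt // eqxx.
case: eqP => // eq_t _; rewrite -(nth_index psi fn) -/(tag f) eq_t.
exact: nth_index.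
Qed.

Lemma tagofP s f : tagof s = Some f <-> f \in nodes /\ istag (tag f) s.
Proof.
rewrite /tagof; split=> [|[fn fs]].
  case E: [seq _ <- _ | _] => [//|g l] [<-].
  have : g \in [seq f <- nodes | istag (tag f) s] by rewrite E mem_head.
  by rewrite mem_filter => /andP[].
have : f \in [seq f <- nodes | istag (tag f) s] by rewrite mem_filter fs.
case E: [seq _ <- _ | _] => [//|g l] _ /=; congr Some.
have : g \in [seq f <- nodes | istag (tag f) s] by rewrite E mem_head.
rewrite mem_filter => /andP[gs gn]; exact: istag_inj gs fs.
Qed.

Lemma iszero_tag s f : iszero s -> f \in nodes -> istag (tag f) s = false.
Proof.
move=> /allP s0 fn; apply/negP => /istagP /(_ _ (tag_lt fn)).
have := s0 (tag f); rewrite mem_iota /= add0n /alen (leq_trans (tag_lt fn) (leq_addr _ _)).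
by move/(_ isT)/eqP->; rewrite eqxx.
Qed.

Lemma iszero_tagof s f : tagof s = Some f -> iszero s = false.
Proof.
by case/tagofP=> fn fs; apply/negP => s0; rewrite (iszero_tag s0 fn) in fs.
Qed.

Lemma wirebP n su sv : reflect
  ((iszero sv /\ tagof su = Some theta /\ dom n (regs su)) \/
   exists f g, [/\ tagof sv = Some f, tagof su = Some g & step f g (regs sv) (regs su)])
  (wireb n su sv).
Proof.
apply: (iffP orP) => [[/and3P[z t d]|/hasP[f fn /hasP[g gn /and3P[tf tg st]]]]|].
- by left; split=> //; split=> //; apply/tagofP; rewrite theta_nodes.
- by right; exists f, g; split=> //; apply/tagofP.
case=> [[z [/tagofP[_ t] d]]|[f [g [/tagofP[fn tf] /tagofP[gn tg] st]]]].
  by left; rewrite z t d.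
by right; apply/hasP; exists f => //; apply/hasP; exists g => //; rewrite tf tg.
Qed.

(** ** Depth *)

Definition hmax : nat := (height psi + height theta).+1.

Lemma height_nodes f : f \in nodes -> height f < hmax.
Proof.
rewrite mem_undup mem_cat /hmax ltnS => /orP[] /height_subforms h.
  exact: leq_trans h (leq_addr _ _).
exact: leq_trans h (leq_addl _ _).
Qed.

(** A lexicographic order packed into one number: a wire to a subformula lowers the height at
    constant rank, a call lowers the rank and may reset the height to anything below [hmax]. *)
Definition level (n : nat) (s : env) : nat :=
  if iszero s then hmax * (rank n).+1
  else if tagof s is Some f then height f + hmax * rank (regs s 0) else 0.

Lemma level_node n s f : tagof s = Some f -> bounded n s -> level n s < hmax * (rank n).+1.
Proof.
move=> sf bs; rewrite /level (iszero_tagof sf) sf mulnS -addSn.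
apply: leq_add; first by case/tagofP: sf => /height_nodes.
by rewrite leq_mul2l rank_leq ?orbT // bs.
Qed.

Lemma level_max n s : bounded n s -> level n s <= hmax * (rank n).+1.
Proof.
move=> bs; case E: (tagof s) => [f|]; first exact/ltnW/(level_node E).
by rewrite /level E; case: ifP.
Qed.

Lemma level_wire n su sv : bounded n su -> wireb n su sv -> level n su < level n sv.
Proof.
move=> bu /wirebP[[z [t _]]|[f [g [tf tg]]]].
  by rewrite [level n sv]/level z; exact: level_node t bu.
rewrite /level (iszero_tagof tf) (iszero_tagof tg) tf tg.
have gn : g \in nodes by case/tagofP: tg.
have eq0 e e' : all (fun r => e r == e' r) (iota 0 K) -> e 0 = e' 0 :> nat.
  by move/allP/(_ 0); rewrite mem_iota /= add0n K_gt0 => /(_ isT)/eqP.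
have eq0j e e' j : 0 < j -> all (fun r => (r == j) || (e r == e' r)) (iota 0 K) ->
    e 0 = e' 0 :> nat.
  move=> j0 /allP/(_ 0); rewrite mem_iota /= add0n K_gt0 => /(_ isT).
  by rewrite (ltn_eqF j0) => /eqP.
have fok : regs_ok K f by apply: regs_ok_nodes; case/tagofP: tf.
have := @height_children f g.
case: f fok tf => [i|a|s|f|f1 f2|f1 f2|j f|j f] //= fok tf hc.
- case/and3P=> _ /eq0 e0 /rank_guard ru; rewrite add0n.
  apply: leq_trans (_ : hmax * (rank (regs su 0)).+1 <= _).
    by rewrite mulnS ltn_add2r height_nodes.
  by rewrite leq_mul2l ru orbT.
- by case/andP=> /hc hg /eq0 ->; rewrite ltn_add2r.
- by case/andP=> /hc hg /eq0 ->; rewrite ltn_add2r.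
- by case/andP=> /hc hg /eq0 ->; rewrite ltn_add2r.
- case/andP: fok => /andP[j0 _] _.
  by case/andP=> /hc hg /(eq0j _ _ _ j0) e0; rewrite e0 ltn_add2r.
- case/andP: fok => /andP[j0 _] _.
  by case/andP=> /hc hg /(eq0j _ _ _ j0) e0; rewrite e0 ltn_add2r.
Qed.

Lemma aval_bounded n v : bounded n (@aval n v).
Proof.
move=> i; rewrite /aval /values; case: (ltnP i (size v)) => iv.
  by rewrite (nth_map ord0) // leq_ord.
by rewrite nth_default // size_map.
Qed.

Lemma rec_circuit_lev n (u v : gate (rec_circuit n)) :
  wire u v -> level n (aval u) < level n (aval v).
Proof. by apply: level_wire; exact: aval_bounded. Qed.

Lemma rec_circuit_acyclic n : acyclic (rec_circuit n).
Proof. exact: (lev_acyclic (@rec_circuit_lev n)). Qed.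

Lemma rec_circuit_depth n : depth_le (rec_circuit n) (hmax * (rank n).+1).
Proof.
apply: (lev_depth (@rec_circuit_lev n)) => v; apply: level_max; exact: aval_bounded.
Qed.

(** ** Addresses *)

Definition mk (n t : nat) (e : env) : alen.-tuple 'I_n.+1 :=
  [tuple inord (if i < ntags then (i == t :> nat) : nat else e (i - ntags)) | i < alen].

Lemma aval_tnth n (v : alen.-tuple 'I_n.+1) (i : 'I_alen) : aval v i = tnth v i.
Proof. by rewrite /aval /values (nth_map ord0) ?size_tuple // -tnth_nth. Qed.

Lemma aval_mk n t e i : 0 < n -> bounded n e -> i < alen ->
  aval (mk n t e) i = if i < ntags then (i == t) : nat else e (i - ntags).
Proof.
move=> n0 be il; rewrite (aval_tnth (mk n t e) (Ordinal il)) tnth_mktuple inordK //= ltnS.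
by case: ifP => // _; case: (_ == _).
Qed.

Lemma eq_aval n (u v : alen.-tuple 'I_n.+1) :
  (forall i, i < alen -> aval u i = aval v i) -> u = v.
Proof.
move=> uv; apply: eq_from_tnth => i; apply: val_inj.
by have := uv i (ltn_ord i); rewrite !aval_tnth.
Qed.

Lemma istag_mk n t e : 0 < n -> bounded n e -> istag t (aval (mk n t e)).
Proof.
move=> n0 be; apply/istagP => i it.
by rewrite aval_mk ?it // (leq_trans it) // leq_addr.
Qed.

Lemma regs_mk n t e : 0 < n -> bounded n e -> regs (aval (mk n t e)) = normal e.
Proof.
move=> n0 be; apply: functional_extensionality => r; rewrite /regs /normal.
have rK : (if r < K then r else 0) < K by case: ifP.
by rewrite aval_mk // ?ltn_add2l // ltnNge leq_addr /= addKn.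
Qed.

Lemma mk_regs n t v : istag t (aval v) -> v = mk n t (regs (aval v)).
Proof.
move=> tv; apply: eq_aval => i il.
have [n0|n0] := posnP n.
  have z (u : alen.-tuple 'I_n.+1) : aval u i = 0.
    by apply/eqP; rewrite -leqn0; apply: leq_trans (aval_bounded u i) _; rewrite n0.
  by rewrite !z.
have be : bounded n (regs (aval v)) by move=> r; exact: aval_bounded.
rewrite aval_mk //; case: ifP => it; first by move/istagP: tv => ->.
rewrite /regs; have -> : i - ntags < K by rewrite /alen in il; lia.
by congr (aval v); lia.
Qed.

Lemma mk_ext n t e e' : (forall r, r < K -> e r = e' r) -> mk n t e = mk n t e'.
Proof.
move=> ee; apply: eq_from_tnth => i; rewrite !tnth_mktuple; case: ifP => // it.
by rewrite ee //; have := ltn_ord i; rewrite /alen in i it *; lia.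
Qed.

Lemma tagof_mk n f e : 0 < n -> bounded n e -> f \in nodes ->
  tagof (aval (mk n (tag f) e)) = Some f.
Proof. by move=> n0 be fn; apply/tagofP; rewrite istag_mk. Qed.

(** ** Evaluation *)

Definition node (n : nat) (f : xform) (e : env) : gate (rec_circuit n) := mk n (tag f) e.

Lemma regs_bounded n (u : gate (rec_circuit n)) : bounded n (regs (aval u)).
Proof. by move=> r; exact: aval_bounded. Qed.

Lemma fan_in_node n f e u : 0 < n -> f \in nodes -> bounded n e -> normal e = e ->
  (u \in fan_in (node n f e)) <->
  exists2 g, tagof (aval u) = Some g & step f g e (regs (aval u)).
Proof.
move=> n0 fn be ne; rewrite inE; split.
  case/wirebP=> [[z _]|[f' [g []]]].
    by rewrite (iszero_tagof (tagof_mk n0 be fn)) in z.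
  by rewrite tagof_mk // => -[<-] tg; rewrite regs_mk // ne; exists g.
case=> g tg st; apply/wirebP; right; exists f, g.
by rewrite tagof_mk // regs_mk // ne.
Qed.

Lemma tagof_node n (u : gate (rec_circuit n)) g e : tagof (aval u) = Some g ->
  (forall r, r < K -> regs (aval u) r = e r) -> u = node n g e.
Proof. by case/tagofP=> _ /mk_regs {2}-> ee; exact: mk_ext. Qed.

Lemma fan_in_children n f e u : 0 < n -> f \in nodes -> bounded n e -> normal e = e ->
  match f with XNot _ | XAnd _ _ | XOr _ _ => true | _ => false end ->
  reflect (exists2 g, g \in children f & u = node n g e) (u \in fan_in (node n f e)).
Proof.
move=> n0 fn be ne fk; apply: (iffP idP).
  case/(fan_in_node _ n0 fn be ne)=> g tg st; exists g.
    by case: f fk st {fn} => //= [?|? ?|? ?] _ /andP[].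
  apply: tagof_node tg _ => r rK; apply/eqP.
  have /allP : all (fun r => regs (aval u) r == e r) (iota 0 K).
    by case: f fk st {fn} => //= [?|? ?|? ?] _ /andP[].
  by apply; rewrite mem_iota.
case=> g gf ->; apply/(fan_in_node _ n0 fn be ne); exists g.
  by rewrite tagof_mk // (children_nodes fn gf).
rewrite regs_mk // ne; have all_e : all (fun r => e r == e r) (iota 0 K).
  by apply/allP => r _.
by case: f fk gf {fn} => //= [?|? ?|? ?] _ ->.
Qed.

Lemma normal_upd e j a : 0 < j < K -> normal e = e -> normal (upd e j a) = upd e j a.
Proof.
case/andP=> j0 jK ne; apply: functional_extensionality => r.
rewrite /normal /upd; case: ltnP => // Kr.
rewrite (ltn_eqF j0) (gtn_eqF (leq_trans jK Kr)) -{2}ne /normal.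
by rewrite ltnNge Kr.
Qed.

Lemma bounded_upd n e j (a : 'I_n.+1) : bounded n e -> bounded n (upd e j a).
Proof. by move=> be r; rewrite /upd; case: ifP => // _; exact: leq_ord. Qed.

Lemma fan_in_quant n f j g e u : 0 < n -> f \in nodes -> bounded n e -> normal e = e ->
  0 < j < K -> f = XEx j g \/ f = XAll j g ->
  reflect (exists a : 'I_n.+1, u = node n g (upd e j a)) (u \in fan_in (node n f e)).
Proof.
move=> n0 fn be ne jK fk.
have gn : g \in nodes by apply: (children_nodes fn); case: fk => ->; rewrite inE.
have stE h eu : step f h e eu =
    (h == g) && all (fun r => (r == j) || (eu r == e r)) (iota 0 K).
  by case: fk => ->; rewrite /= inE.
apply: (iffP idP) => [/(fan_in_node _ n0 fn be ne)[h th]|[a ->]].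
  rewrite stE => /andP[/eqP eh /allP al]; rewrite eh in th.
  exists (inord (regs (aval u) j)); apply: tagof_node th _ => r rK.
  rewrite inordK ?ltnS ?regs_bounded // /upd; case: eqP => [->//|/eqP rj].
  by have := al r; rewrite mem_iota rK (negPf rj) => /(_ isT)/eqP.
apply/(fan_in_node _ n0 fn be ne); exists g.
  by rewrite tagof_mk //; exact: bounded_upd.
rewrite stE eqxx regs_mk //; last exact: bounded_upd.
rewrite normal_upd //; apply/allP => r _; rewrite /upd; case: (r == j) => //=.
Qed.

Lemma fan_in_rec n s e u : 0 < n -> XRec s \in nodes -> bounded n e -> normal e = e ->
  (u \in fan_in (node n (XRec s) e)) =
  guard (e 0) (call_env s e 0) && (u == node n psi (call_env s e)).
Proof.
move=> n0 fn be ne; have bc : bounded n (call_env s e) by move=> r; exact: be.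
apply/idP/andP => [/(fan_in_node _ n0 fn be ne)[h th]|[gu /eqP->]].
  case/and3P=> /eqP eh /allP al gu; rewrite eh in th.
  have eq_r r : r < K -> regs (aval u) r = call_env s e r.
    by move=> rK; apply/eqP/al; rewrite mem_iota.
  by rewrite -eq_r // gu; split=> //; apply/eqP/tagof_node.
apply/(fan_in_node _ n0 fn be ne); exists psi; first by rewrite tagof_mk // psi_nodes.
rewrite /= eqxx regs_mk //=; apply/andP; split; last by rewrite /normal K_gt0.
by apply/allP => r; rewrite mem_iota add0n /normal /= => ->.
Qed.

(** The values of the [psi] gates stay an opaque predicate, so structural induction on the formula
    suffices. The instance [f = psi] is the recursion equation for that predicate. *)
Lemma eval_node n x w f e : 0 < n -> f \in nodes -> bounded n e -> normal e = e ->
  value x w (node n f e) = xsat n x (fun e => value x w (node n psi e)) f e.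
Proof.
move=> n0; have ac := @rec_circuit_acyclic n.
elim: f e => [i|a|s|f IH|f IHf g IHg|f IHf g IHg|j f IH|j f IH] e fn be ne;
  rewrite valueE //= /kindb (iszero_tagof (tagof_mk n0 be fn)) tagof_mk //= ?regs_mk // ?ne.
- case: insubP => [k _ kE|ei]; first by rewrite (tnth_nth false) kE.
  rewrite nth_default; last by rewrite size_tuple leqNgt.
  apply/existsP => -[u /andP[]].
  by case/(fan_in_node _ n0 fn be ne).
- case: ifP => sa; last first.
    by apply/existsP => -[u /andP[]]; case/(fan_in_node _ n0 fn be ne).
  by apply/forallP => u; apply/implyP; case/(fan_in_node _ n0 fn be ne).
- apply/existsP/andP => [[u]|[gu rv]].
    by rewrite fan_in_rec // => /andP[/andP[gu /eqP->] rv].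
  by exists (node n psi (call_env s e)); rewrite fan_in_rec // gu eqxx.
- have fn' : f \in nodes by apply: (children_nodes fn); rewrite inE.
  rewrite -IH //; congr (~~ _); apply/exists_inP/idP => [[u]|vf].
    by case/(fan_in_children _ n0 fn be ne isT) => g; rewrite inE => /eqP-> ->.
  exists (node n f e) => //; apply/(fan_in_children _ n0 fn be ne isT).
  by exists f; rewrite ?inE.
- have fn' : f \in nodes by apply: (children_nodes fn); rewrite inE eqxx.
  have gn' : g \in nodes by apply: (children_nodes fn); rewrite !inE eqxx orbT.
  rewrite -IHf // -IHg //; apply/forall_inP/andP => [al|[vf vg] u].
    by split; apply: al; apply/(fan_in_children _ n0 fn be ne isT);
       [exists f | exists g]; rewrite ?inE ?eqxx ?orbT.
  by case/(fan_in_children _ n0 fn be ne isT) => h; rewrite !inE => /orP[]/eqP-> ->.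
- have fn' : f \in nodes by apply: (children_nodes fn); rewrite inE eqxx.
  have gn' : g \in nodes by apply: (children_nodes fn); rewrite !inE eqxx orbT.
  rewrite -IHf // -IHg //; apply/exists_inP/orP => [[u]|].
    case/(fan_in_children _ n0 fn be ne isT) => h.
    by rewrite !inE => /orP[]/eqP-> -> v; [left|right].
  case=> v; [exists (node n f e)|exists (node n g e)] => //;
    apply/(fan_in_children _ n0 fn be ne isT);
    by [exists f; rewrite ?inE ?eqxx ?orbT|exists g; rewrite ?inE ?eqxx ?orbT].
- have fn' : f \in nodes by apply: (children_nodes fn); rewrite inE eqxx.
  have /= /andP[jK _] := regs_ok_nodes fn.
  have vE (a : 'I_n.+1) := IH _ fn' (bounded_upd j a be) (normal_upd a jK ne).
  apply/exists_inP/existsP => [[u /(fan_in_quant _ n0 fn be ne jK (or_introl erefl))[a ->]]|].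
    by rewrite vE; exists a.
  case=> a; rewrite -vE => v; exists (node n f (upd e j a)) => //.
  by apply/(fan_in_quant _ n0 fn be ne jK (or_introl erefl)); exists a.
have fn' : f \in nodes by apply: (children_nodes fn); rewrite inE eqxx.
have /= /andP[jK _] := regs_ok_nodes fn.
have vE (a : 'I_n.+1) := IH _ fn' (bounded_upd j a be) (normal_upd a jK ne).
apply/forall_inP/forallP => [al a|al u].
  rewrite -vE; apply: al; apply/(fan_in_quant _ n0 fn be ne jK (or_intror erefl)).
  by exists a.
case/(fan_in_quant _ n0 fn be ne jK (or_intror erefl)) => a ->.
by rewrite vE.
Qed.

Definition tenv (n : nat) (t : K.-tuple 'I_n.+1) : env :=
  normal (nth 0 (values t)).

Lemma tenv_bounded n t : bounded n (@tenv n t).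
Proof.
move=> i; rewrite /tenv /normal /values; move: (if _ then _ else _) => j.
case: (ltnP j (size t)) => jt; first by rewrite (nth_map ord0) // leq_ord.
by rewrite nth_default // size_map.
Qed.

Lemma tenv_normal n t : normal (@tenv n t) = tenv t.
Proof.
apply: functional_extensionality => r; rewrite /tenv /normal.
by case: (ltnP r K) => [->//|_]; rewrite K_gt0.
Qed.

Lemma tenv_tnth n (t : K.-tuple 'I_n.+1) (i : 'I_K) : tenv t i = tnth t i.
Proof.
by rewrite /tenv /normal ltn_ord /values (nth_map ord0) ?size_tuple // -tnth_nth.
Qed.

Lemma node_tenv_inj n f : 0 < n -> injective (fun t => node n f (@tenv n t)).
Proof.
move=> n0 t t' /(congr1 (fun u => regs (aval u))).
rewrite !regs_mk //; try exact: tenv_bounded.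
rewrite !tenv_normal => tt; apply: eq_from_tnth => i; apply: val_inj.
by rewrite /= -!tenv_tnth tt.
Qed.

Lemma output_aval n i : aval (output (rec_circuit n)) i = 0.
Proof.
have [il|il] := ltnP i alen.
  by rewrite (aval_tnth (output (rec_circuit n)) (Ordinal il)) tnth_mktuple.
by rewrite /aval /values nth_default // size_map size_tuple.
Qed.

Lemma output_zero n : iszero (aval (output (rec_circuit n))).
Proof. by apply/allP => i _; rewrite output_aval. Qed.

Lemma fan_in_output n (u : gate (rec_circuit n)) :
  (u \in fan_in (output (rec_circuit n))) <->
  tagof (aval u) = Some theta /\ dom n (regs (aval u)).
Proof.
rewrite inE; split=> [/wirebP[[_ //]|[f [g [/iszero_tagof]]]]|[t d]].
  by rewrite output_zero.
by apply/wirebP; left; rewrite output_zero.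
Qed.

Lemma eval_output n x w : 0 < n ->
  circuit_value (rec_circuit n) x w =
  (#|[set t : K.-tuple 'I_n.+1 | dom n (tenv t)]| <
   2 * #|[set t : K.-tuple 'I_n.+1 | dom n (tenv t) &&
           xsat n x (fun e => value x w (node n psi e)) theta (tenv t)]|).
Proof.
move=> n0; rewrite /circuit_value -/(value x w _) valueE; last exact: rec_circuit_acyclic.
rewrite /= /kindb output_zero.
have fE u : u \in fan_in (output (rec_circuit n)) <->
    exists2 t : K.-tuple 'I_n.+1, dom n (tenv t) & u = node n theta (tenv t).
  rewrite fan_in_output; split=> [[tu du]|[t dt ->]].
    pose t : K.-tuple 'I_n.+1 := [tuple inord (regs (aval u) i) | i < K].
    have rt : tenv t = regs (aval u).
      apply: functional_extensionality => r; rewrite -tenv_normal.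
      have rK : (if r < K then r else 0) < K by case: ifP.
      rewrite /normal (tenv_tnth _ (Ordinal rK)) tnth_mktuple inordK ?ltnS ?regs_bounded //=.
      by rewrite /regs rK.
    exists t; first by rewrite rt.
    by apply: tagof_node tu _ => r _; rewrite rt.
  rewrite tagof_mk ?theta_nodes // ?regs_mk //; try exact: tenv_bounded.
  by rewrite tenv_normal.
rewrite -(card_imset _ (@node_tenv_inj n theta n0)).
rewrite -[in RHS](card_imset _ (@node_tenv_inj n theta n0)).
congr (_ < 2 * _); apply: eq_card => u.
  apply/idP/imsetP => [/fE[t dt ->]|[t]]; first by exists t; rewrite ?inE.
  by rewrite inE => dt ->; apply/fE; exists t.
rewrite inE; apply/andP/imsetP => [[/fE[t dt ->] vu]|[t]].
  exists t; rewrite // inE dt -eval_node ?theta_nodes //; [exact: tenv_bounded|exact: tenv_normal].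
rewrite inE => /andP[dt vu] ->; split; first by apply/fE; exists t.
by rewrite eval_node ?theta_nodes //; [exact: tenv_bounded|exact: tenv_normal].
Qed.

(** A one-hot tag needs a coordinate equal to 1, absent from a one-element universe. The output then
    has no wires, and Majority requires [0 < 0]. *)
Lemma eval_output0 x w : circuit_value (rec_circuit 0) x w = false.
Proof.
rewrite /circuit_value -/(value x w _) valueE; last exact: rec_circuit_acyclic.
rewrite /= /kindb output_zero.
rewrite (_ : [set u in _ | _] = set0) ?cards0 //; apply/setP => u; rewrite !inE.
apply/negP => /andP[uo _].
have /fan_in_output[/tagofP[tn /istagP tu] _] : u \in fan_in (output (rec_circuit 0)).
  by rewrite inE.
by have := aval_bounded u (tag theta); rewrite tu ?tag_lt // eqxx.
Qed.

Lemma normal_regs s : normal (regs s) = regs s.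
Proof.
apply: functional_extensionality => r; rewrite /normal /regs.
by case: (ltnP r K) => [->//|_]; rewrite K_gt0.
Qed.

Lemma rec_circuit_wf n : well_formed (rec_circuit n).
Proof.
split=> [|v]; first exact: rec_circuit_acyclic.
rewrite /arity_ok /= /kindb; case: ifP => // _; case E: (tagof _) => [f|//].
have [fn fv] := (tagofP _ _).1 E.
have n0 : 0 < n.
  have := aval_bounded v (tag f); move/istagP: (fv) => ->; rewrite ?tag_lt // eqxx.
  by case: (n).
have be := regs_bounded v; have ne := normal_regs (aval v).
have vE : v = node n f (regs (aval v)) by exact: mk_regs.
case: f E fn fv vE => [i|a|s|f|f g|f g|j f|j f] //= E fn fv vE.
- case: insubP => // k _ _; apply: eq_card0 => u; rewrite vE.
  by apply/negP => /(fan_in_node _ n0 fn be ne)[].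
- by case: ifP.
apply/eqP/cards1P; exists (node n f (regs (aval v))); apply/setP => u.
rewrite [in LHS]vE [RHS]inE; apply/(fan_in_children _ n0 fn be ne isT)/eqP.
  by case=> g; rewrite inE => /eqP-> ->.
by move->; exists f; rewrite ?inE.
Qed.

Lemma rec_circuit_maj n : single_output_majority (rec_circuit n).
Proof.
split=> [|v]; first by rewrite /= /kindb output_zero.
rewrite /= /kindb; case: ifP => [/allP v0 _|_].
  apply: eq_aval => i il; rewrite output_aval; apply/eqP/v0.
  by rewrite mem_iota add0n.
case: (tagof _) => // -[i|a|s|f|f g|f g|j f|j f] //=; first by case: insubP.
by case: ifP.
Qed.

(** ** Uniformity *)

Lemma defn_guard i j : defn (fun _ e => guard (e i) (e j)).
Proof.
apply: defn_and; first exact: (@defn_tlt (fun _ _ => 2) i (tdef_const 2)).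
exact: (@defn_tlt (fun _ e => (e j).-1 * (e j).-1) i (tdef_mul (tdef_pred j) (tdef_pred j))).
Qed.

Lemma defn_istag t r : defn (fun _ e => istag t (fun i => e (r i))).
Proof.
apply: (@defn_seq_all _ _ (fun i _ e => e (r i) == (i == t))) => i.
exact: defn_const_eq.
Qed.

Lemma defn_iszero r : defn (fun _ e => iszero (fun i => e (r i))).
Proof.
apply: (@defn_seq_all _ _ (fun i _ e => e (r i) == 0)) => i.
exact: defn_const_eq.
Qed.

Lemma defn_step f g r r' : defn (fun _ e => step f g (fun i => e (r i)) (fun i => e (r' i))).
Proof.
case: f => [i|a|s|f|f1 f2|f1 f2|j f|j f] /=; try exact: defn_false.
- apply: defn_and; first exact: defn_const.
  apply: defn_and; last exact: defn_guard.
  by apply: (@defn_seq_all _ _ (fun i _ e => e (r' i) == e (r (nth i s i)))) => i; exact: defn_eq.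
- apply: defn_and; first exact: defn_const.
  by apply: (@defn_seq_all _ _ (fun i _ e => e (r' i) == e (r i))) => i; exact: defn_eq.
- apply: defn_and; first exact: defn_const.
  by apply: (@defn_seq_all _ _ (fun i _ e => e (r' i) == e (r i))) => i; exact: defn_eq.
- apply: defn_and; first exact: defn_const.
  by apply: (@defn_seq_all _ _ (fun i _ e => e (r' i) == e (r i))) => i; exact: defn_eq.
- apply: defn_and; first exact: defn_const.
  apply: (@defn_seq_all _ _ (fun i _ e => (i == j) || (e (r' i) == e (r i)))) => i.
  by apply: defn_or (defn_const _) (defn_eq _ _).
- apply: defn_and; first exact: defn_const.
  apply: (@defn_seq_all _ _ (fun i _ e => (i == j) || (e (r' i) == e (r i)))) => i.
  by apply: defn_or (defn_const _) (defn_eq _ _).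
Qed.

Lemma defn_wireb : defn (fun n e => wireb n e (fun i => e (alen + i))).
Proof.
apply: defn_or.
  apply: defn_and; first exact: (defn_iszero (addn alen)).
  apply: defn_and; first exact: (defn_istag _ id).
  exact: (defn_ren (fun r => ntags + (if r < K then r else 0)) Ddom).
apply: (@defn_seq_has _ _ (fun f n e => has (fun g =>
  [&& istag (tag f) (fun i => e (alen + i)), istag (tag g) e
    & step f g (regs (fun i => e (alen + i))) (regs e)]) nodes)) => f.
apply: (@defn_seq_has _ _ (fun g n e =>
  [&& istag (tag f) (fun i => e (alen + i)), istag (tag g) e
    & step f g (regs (fun i => e (alen + i))) (regs e)])) => g.
apply: defn_and; first exact: (defn_istag _ (addn alen)).
apply: defn_and; first exact: (defn_istag _ id).
exact: (@defn_step f g (fun r => alen + (ntags + (if r < K then r else 0)))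
  (fun r => ntags + (if r < K then r else 0))).
Qed.

Lemma defn_if P Q S : defn P -> defn Q -> defn S ->
  defn (fun n e => if P n e then Q n e else S n e).
Proof.
move=> DP DQ DS; apply: defn_ext
  (defn_or (defn_and DP DQ) (defn_and (defn_not DP) DS)) => n e _.
by case: (P n e); rewrite ?orbF.
Qed.

(** There are finitely many tags, so the search for the tag of an address unfolds into nested
    conditionals, and a test on kinds only has to be definable formula by formula. *)
Lemma defn_kindb (k : forall n, env -> gate_kind n 0 -> bool) :
  (forall f, defn (fun n s => k n s (kindf n f (regs s)))) ->
  defn (fun n s => k n s Maj) -> defn (fun n s => k n s And) ->
  defn (fun n s => k n s (kindb n s)).
Proof.
move=> Dk Dmaj Dand; rewrite /kindb /tagof.
have Dl l : defn (fun n s => k n s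
    (if ohead [seq f <- l | istag (tag f) s] is Some f then kindf n f (regs s) else And)).
  elim: l => [//|f l IH] /=.
  apply: defn_ext (defn_if (defn_istag (tag f) id) (Dk f) IH) => n e _.
  by case: ifP.
apply: defn_ext (defn_if (defn_iszero id) Dmaj (Dl nodes)) => n e _.
by case: ifP.
Qed.

Lemma defn_lt_top i : defn (fun n e => e i < n).
Proof.
apply: defn_ext (defn_not (defn_top i)) => n e be.
by rewrite ltn_neqAle be andbT.
Qed.

Definition regi (j : nat) : nat := ntags + (if j < K then j else 0).

Lemma defn_fsat g : defn (fun n s => fsat n g (regs s)).
Proof. exact: (defn_ren regi (@Defn (fun n e => fsat n g e) g (fun n e be => erefl))). Qed.

Lemma defn_kind_and : defn (fun n s => if kindb n s is And then true else false).
Proof.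
apply: (@defn_kindb (fun n s k => if k is And then true else false)); try exact: defn_const.
case=> [i|a|s|f|f g|f g|j f|j f]; try exact: defn_const.
  by apply: defn_ext defn_false => n e _; rewrite /=; case: insubP.
by apply: defn_ext (defn_fsat a) => n e _ /=; case: ifP.
Qed.

Lemma defn_kind_or : defn (fun n s => if kindb n s is Or then true else false).
Proof.
apply: (@defn_kindb (fun n s k => if k is Or then true else false)); try exact: defn_const.
case=> [i|a|s|f|f g|f g|j f|j f]; try exact: defn_const.
  apply: defn_ext (defn_not (defn_lt_top (regi i))) => n e _ /=.
  by rewrite -/(regi i) /regs; case: insubP => [k ->|/negPf->].
by apply: defn_ext (defn_not (defn_fsat a)) => n e _ /=; case: ifP.
Qed.

Lemma defn_kind_not : defn (fun n s => if kindb n s is Not then true else false).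
Proof.
apply: (@defn_kindb (fun n s k => if k is Not then true else false)); try exact: defn_const.
case=> [i|a|s|f|f g|f g|j f|j f]; try exact: defn_const.
  by apply: defn_ext defn_false => n e _; rewrite /=; case: insubP.
by apply: defn_ext defn_false => n e _ /=; case: ifP.
Qed.

Lemma defn_kind_maj : defn (fun n s => if kindb n s is Maj then true else false).
Proof.
apply: (@defn_kindb (fun n s k => if k is Maj then true else false)); try exact: defn_const.
case=> [i|a|s|f|f g|f g|j f|j f]; try exact: defn_const.
  by apply: defn_ext defn_false => n e _; rewrite /=; case: insubP.
by apply: defn_ext defn_false => n e _ /=; case: ifP.
Qed.

Lemma defn_kind_input :
  defn (fun n s => if kindb n s is Input i then i == s alen :> nat else false).
Proof.
apply: (@defn_kindb (fun n s k => if k is Input i then i == s alen :> nat else false));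
  try exact: defn_const.
case=> [i|a|s|f|f g|f g|j f|j f]; try exact: defn_const.
  apply: defn_ext (defn_and (defn_lt_top (regi i)) (defn_eq (regi i) alen)) => n e _ /=.
  by rewrite -/(regi i) /regs; case: insubP => [k -> ->|/negPf->].
by apply: defn_ext defn_false => n e _ /=; case: ifP.
Qed.

(** In the connection language an address is followed by further coordinates, of a second gate or of
    an input index; nothing at or past [alen] may influence it. *)
Lemma istag_ext t s s' : (forall i, i < alen -> s i = s' i) -> istag t s = istag t s'.
Proof.
move=> ss; apply: eq_in_all => i; rewrite mem_iota add0n => /= it; rewrite ss //.
by rewrite (leq_trans it) // leq_addr.
Qed.

Lemma regs_ext s s' : (forall i, i < alen -> s i = s' i) -> regs s = regs s'.
Proof.
move=> ss; apply: functional_extensionality => r; apply: ss.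
by rewrite ltn_add2l; case: ifP.
Qed.

Lemma kindb_ext n s s' : (forall i, i < alen -> s i = s' i) -> kindb n s = kindb n s'.
Proof.
move=> ss; rewrite /kindb (regs_ext ss) /tagof.
have -> : iszero s = iszero s'.
  by apply: eq_in_all => i; rewrite mem_iota add0n => /= it; rewrite ss.
by under eq_filter do rewrite (istag_ext _ ss).
Qed.

Lemma wireb_ext n s s' t : (forall i, i < alen -> s i = s' i) -> wireb n s t = wireb n s' t.
Proof.
move=> ss; rewrite /wireb (regs_ext ss) (istag_ext _ ss); congr (_ || _).
by apply: eq_has => f; apply: eq_has => g; rewrite (istag_ext _ ss).
Qed.

Lemma values_inj n k : injective (@values n k).
Proof. by move=> t t' /(inj_map val_inj) /val_inj. Qed.

Lemma values_cat n p q (t : (p + q).-tuple 'I_n.+1) :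
  values t = values [tuple tnth t (lshift q i) | i < p] ++
             values [tuple tnth t (rshift p i) | i < q].
Proof.
rewrite /values -map_cat; congr map; apply: (@eq_from_nth _ ord0).
  by rewrite size_cat !size_tuple.
rewrite size_tuple => i ipq; rewrite nth_cat size_tuple.
case: ltnP => ip.
  rewrite -(tnth_nth _ _ (Ordinal ip)) tnth_mktuple -(tnth_nth _ _ (Ordinal ipq)).
  by congr tnth; apply: val_inj.
have iq : i - p < q by lia.
rewrite -(tnth_nth _ _ (Ordinal iq)) tnth_mktuple -(tnth_nth _ _ (Ordinal ipq)).
by congr tnth; apply: val_inj => /=; lia.
Qed.

Lemma fo_definable_kind (k : forall n, gate_kind n 0) (b : forall n, gate_kind n 0 -> bool) :
  (forall n k', b n k' <-> k' = k n) -> defn (fun n s => b n (kindb n s)) ->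
  fo_definable alen (fun n s =>
    exists v : gate (rec_circuit n), kind v = k n /\ s = values v).
Proof.
move=> bE [f fP]; exists f => n t; rewrite satE fP; last exact: (@aval_bounded n t).
rewrite bE; split=> [kt|[v [kv /values_inj ->]]]; last exact: kv.
by exists t.
Qed.

Lemma nth_values_bounded n k (t : k.-tuple 'I_n.+1) : bounded n (nth 0 (values t)).
Proof.
move=> i; rewrite /values; case: (ltnP i (size t)) => it.
  by rewrite (nth_map ord0) // leq_ord.
by rewrite nth_default // size_map.
Qed.

Lemma rec_circuit_uniform : fo_uniform rec_circuit.
Proof.
exists alen, (fun n v => v); split; first by move=> n u v.
split.
  by apply: (@fo_definable_kind (fun _ => And)
    (fun n k => if k is And then true else false) _ defn_kind_and) => n []; split.
split; first by apply: (@fo_definable_kind (fun _ => Or)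
    (fun n k => if k is Or then true else false) _ defn_kind_or) => n []; split.
split; first by apply: (@fo_definable_kind (fun _ => Not)
    (fun n k => if k is Not then true else false) _ defn_kind_not) => n []; split.
split; first by apply: (@fo_definable_kind (fun _ => Maj)
    (fun n k => if k is Maj then true else false) _ defn_kind_maj) => n []; split.
split.
  have [f fP] := defn_kind_input; exists f => n t.
  rewrite satE fP; last exact: nth_values_bounded.
  rewrite values_cat; set u := [tuple _ | i < alen]; set w := [tuple _ | i < 1].
  have eu i : i < alen -> nth 0 (values u ++ values w) i = aval u i.
    by move=> il; rewrite nth_cat size_map size_tuple il.
  have ew : nth 0 (values u ++ values w) alen = tnth w ord0.
    rewrite nth_cat size_map size_tuple ltnn subnn /values (nth_map ord0) ?size_tuple //.
    by rewrite (tnth_nth ord0).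
  have wE : values w = [:: tnth w ord0 : nat].
    apply: (@eq_from_nth _ 0); rewrite size_map size_tuple // => -[|//] _.
    by rewrite (nth_map ord0) ?size_tuple // (tnth_nth ord0).
  clearbody u w; rewrite (kindb_ext n eu) ew wE; split=> [|[v [i [kv]]]].
    case E: (kindb n _) => [i||||| ] // /eqP iw; exists u, i; split=> //.
    by rewrite -iw.
  rewrite -[in LHS]wE => /eqP; rewrite eqseq_cat ?size_map ?size_tuple //.
  case/andP=> /eqP/values_inj -> /eqP; rewrite wE => -[->].
  by move: kv => /= ->.
split.
  have [f fP] := defn_false; exists f => n t.
  by rewrite satE fP; [split=> // -[v [[]]] | exact: nth_values_bounded].
split.
  have [f fP] := defn_wireb; exists f => n t.
  rewrite satE fP; last exact: nth_values_bounded.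
  rewrite values_cat; set u := [tuple _ | i < alen]; set v := [tuple _ | i < alen].
  have eu i : i < alen -> nth 0 (values u ++ values v) i = aval u i.
    by move=> il; rewrite nth_cat size_map size_tuple il.
  have ev : (fun i => nth 0 (values u ++ values v) (alen + i)) = aval v.
    apply: functional_extensionality => i.
    by rewrite nth_cat size_map size_tuple ltnNge leq_addr /= addKn.
  clearbody u v; rewrite (wireb_ext n _ eu) ev; split=> [uv|[u' [v' [uv /eqP]]]].
    by exists u, v.
  rewrite eqseq_cat ?size_map ?size_tuple //.
  by case/andP=> /eqP/values_inj -> /eqP/values_inj ->.
have [f fP] := defn_iszero id; exists f => n t.
rewrite satE fP; last exact: nth_values_bounded.
split=> [/allP t0|/values_inj ->]; last exact: output_zero.
congr values; apply: eq_aval => i il; rewrite output_aval; apply/eqP/t0.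
by rewrite mem_iota add0n.
Qed.

(** From [up_log 2 n <= 2 * log2 n] and the fact that doubling adds one to the logarithm, [rank n]
    is at most [log2 (log2 n) + 2]. Adding one more gives at most four times [log2 (log2 n)], which
    is positive from [n = 4] on. *)
Lemma rank_bigO h : bigO (fun n => h * (rank n).+1) (fun n => log2 (log2 n)).
Proof.
exists (4 * h), 4 => n n4; rewrite [4 * h]mulnC -mulnA leq_mul2l; apply/orP; right.
have ul a : 0 < a -> up_log 2 a <= (log2 a).+1.
  move=> a0; apply: up_log_min => //.
  by have /andP[_ /ltnW] := trunc_log_bounds (isT : 1 < 2) a0.
have l2 : 2 <= log2 n by apply: trunc_log_max.
have l1 : 1 <= log2 (log2 n) by apply: trunc_log_max.
suff : rank n <= (log2 (log2 n)).+2 by lia.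
have un : up_log 2 n <= 2 * log2 n by have := ul n; lia.
apply: leq_trans (leq_up_log _ un) _; rewrite up_logMp //; last by lia.
by rewrite ltnS ul //; lia.
Qed.

(** From here on circuits disappear: any [R] obeying the recursion equation stands for the gate
    values. The empty word is set apart because the circuit of length 0 rejects. *)
Theorem majority_recursion (L : language) :
  ~ L [::] ->
  (forall n (x : n.-tuple bool) (R : env -> bool), 0 < n ->
     (forall e, bounded n e -> R e = xsat n x R psi (normal e)) ->
     L x <-> #|[set t : K.-tuple 'I_n.+1 | dom n (tenv t)]| <
       2 * #|[set t : K.-tuple 'I_n.+1 | dom n (tenv t) && xsat n x R theta (tenv t)]|) ->
  beta1_MAC0_FOLL L.
Proof.
move=> L0 LE; exists (fun _ => 0), rec_circuit; split; first by exists 0, 0.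
split; first exact: rec_circuit_wf.
split; first exact: rec_circuit_maj.
split.
  exists alen, (2 ^ alen), 1 => n n1.
  rewrite /circuit_size /= card_tuple card_ord -expnMn.
  rewrite leq_exp2r ?(leq_trans K_gt0 (leq_addl _ _)) //.
  by lia.
split.
  exists (fun n => hmax * (rank n).+1).
  by split; [exact: rank_bigO|exact: rec_circuit_depth].
split; first exact: rec_circuit_uniform.
move=> n x; have [n0|n0] := posnP n.
  move: x; rewrite n0 => x; rewrite (tuple0 x).
  by split=> // -[w]; rewrite eval_output0.
pose w0 : 0.-tuple bool := [tuple].
rewrite (LE n x (fun e => value x w0 (node n psi e)) n0); last first.
  move=> e be; have bn : bounded n (normal e) by move=> r; exact: be.
  have nn : normal (normal e) = normal e.
    apply: functional_extensionality => r; rewrite /normal.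
    by case: (ltnP r K) => [->//|_]; rewrite K_gt0.
  rewrite -eval_node ?psi_nodes //; congr value; apply: mk_ext => r rK.
  by rewrite /normal rK.
rewrite -(eval_output x w0 n0); split=> [c|[w]]; first by exists w0.
by rewrite (tuple0 w).
Qed.

End Compile.

(** * Torsion counts determine a finite Abelian group *)

Section TorsionCount.
Local Open Scope group_scope.
Implicit Types (gT : finGroupType) (d : nat).

(** If [ab] is killed by [d] and the factors commute, then [b ^+ d] lies in both subgroups and is
    trivial. Multiplication thus restricts to a bijection from pairs of killed elements. *)
Lemma card_Ldiv_dprod gT (A B G : {group gT}) d : A \x B = G ->
  #|'Ldiv_d(G)| = (#|'Ldiv_d(A)| * #|'Ldiv_d(B)|)%N.
Proof.
move=> defG; case/dprodP: (defG) => _ mAB cAB tiAB.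
have cm a b : a \in A -> b \in B -> commute a b.
  by move=> Aa Bb; exact/esym/(centsP cAB).
rewrite -cardsX -(card_in_imset (f := fun p : gT * gT => p.1 * p.2)).
  apply: eq_card => x; apply/LdivP/imsetP.
    case; rewrite -mAB => /mulsgP[a b Aa Bb ->]; rewrite expgMn; last exact: cm.
    move=> ab1.
    have bA : b ^+ d \in A.
      by rewrite -(groupMl _ (groupX d Aa)) ab1 group1.
    have b1 : b ^+ d = 1.
      by apply/eqP; rewrite -in_set1 -[[set 1]]tiAB inE bA groupX.
    have a1 : a ^+ d = 1 by rewrite b1 mulg1 in ab1.
    by exists (a, b); rewrite // inE; apply/andP; split; apply/LdivP.
  case=> -[a b]; rewrite inE => /andP[/LdivP[Aa a1] /LdivP[Bb b1]] ->.
  by rewrite -mAB mem_mulg //= expgMn ?a1 ?b1 ?mulg1 //; exact: cm.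
move=> [a b] [a' b'] /=; rewrite !inE /= => /andP[/andP[Aa _] /andP[Bb _]].
move=> /andP[/andP[Aa' _] /andP[Bb' _]] eq_ab.
have e : a'^-1 * a = b' * b^-1.
  by apply: (mulIg b); rewrite -!mulgA mulVg mulg1 eq_ab mulKg.
have : a'^-1 * a \in A :&: B by rewrite inE {2}e !groupM ?groupV.
rewrite tiAB inE => /eqP e1; rewrite e1 in e.
by congr (_, _); [apply/esym/(mulgI a'^-1); rewrite e1 mulVg
                 |apply/(mulIg b^-1); rewrite mulgV -e].
Qed.

(** A cyclic group has one subgroup of each order dividing its own; the elements killed by [d] form
    the one of order [gcdn d #[x]]. *)
Lemma card_Ldiv_cycle gT (x : gT) d : #|'Ldiv_d(<[x]>)| = gcdn d #[x].
Proof.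
set g := gcdn d #[x]; have go : g %| #[x] by exact: dvdn_gcdr.
have g0 : 0 < g by rewrite gcdn_gt0 order_gt0 orbT.
have og : #[x ^+ (#[x] %/ g)] = g.
  rewrite orderXdiv ?dvdn_div // divnA // mulKn ?order_gt0 //.
suff -> : 'Ldiv_d(<[x]>) = <[x ^+ (#[x] %/ g)]> by rewrite -orderE.
apply/setP => y; apply/LdivP/idP => [[yx yd]|yg].
  have oy : #[y] %| g.
    by rewrite dvdn_gcd order_dvdn yd eqxx /= [#[y]]orderE [#[x]]orderE cardSg // cycle_subG.
  rewrite -cycle_subG -(cardSg_cyclic (cycle_cyclic x)) ?cycle_subG ?mem_cycle //.
  by rewrite -!orderE og.
split; first by apply: (subsetP _ _ yg); rewrite cycle_subG mem_cycle.
apply/eqP; rewrite -order_dvdn; apply: dvdn_trans (dvdn_gcdl d #[x]).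
by rewrite -/g -og; exact: order_dvdG.
Qed.

Lemma card_Ldiv_bigdprod gT (b : seq gT) (G : {group gT}) d :
  \big[dprod/1]_(x <- b) <[x]> = G ->
  #|'Ldiv_d(G)| = (\prod_(m <- map order b) gcdn d m)%N.
Proof.
elim: b G => [|x b IH] G; rewrite ?big_nil ?big_cons /=.
  move=> <-; rewrite (_ : 'Ldiv_d(1) = 1) ?cards1 //.
  apply/setP => y; apply/LdivP/set1gP => [[/set1gP]//|->].
  by rewrite expg1n inE.
move=> defG; case/dprodP: (defG) => -[A B -> defB] _ _ _.
rewrite defB in defG; rewrite -(IH B defB) -card_Ldiv_cycle.
exact: card_Ldiv_dprod.
Qed.

End TorsionCount.

Lemma prod_gcd_leq d (s : seq nat) : all (leq 1) s ->
  0 < \prod_(m <- s) gcdn d m <= \prod_(m <- s) m.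
Proof.
elim: s => [|a s IH] /=; rewrite ?big_nil // !big_cons => /andP[a0 /IH /andP[l1 l2]].
rewrite muln_gt0 gcdn_gt0 a0 orbT l1 /=; apply: leq_mul => //.
by apply: dvdn_leq => //; exact: dvdn_gcdr.
Qed.

Lemma prod_gcd_full d (s : seq nat) : all (dvdn^~ d) s ->
  \prod_(m <- s) gcdn d m = \prod_(m <- s) m.
Proof.
elim: s => [|a s IH] /=; rewrite ?big_nil // !big_cons => /andP[a0 /IH ->].
by rewrite (gcdn_idPr a0).
Qed.

(* The largest invariant factor is the least [d] at which the product is maximal. *)
Lemma invariant_factors_inj (s t : seq nat) :
  sorted [rel m n | n %| m] s -> sorted [rel m n | n %| m] t ->
  all [pred m | m > 1] s -> all [pred m | m > 1] t ->
  (forall d, \prod_(m <- s) gcdn d m = \prod_(m <- t) gcdn d m) -> s = t.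
Proof.
have dtr : transitive [rel m n | n %| m] by move=> a b c /= ba ac; exact: dvdn_trans ac ba.
have pos u : all [pred m | m > 1] u -> all (leq 1) u by apply: sub_all => m /ltnW.
have nonnil a u : all [pred m | m > 1] (a :: u) ->
    (forall d, \prod_(m <- a :: u) gcdn d m = 1) -> False.
  move=> /= /andP[a1 /pos u1] /(_ a); rewrite big_cons gcdnn.
  by case/andP: (prod_gcd_leq a u1) => p0 _ /eqP; rewrite muln_eq1 (gtn_eqF a1).
elim: s t => [|a s IH] [|b t] // ss st s1 t1 E.
- by case: (nonnil b t t1) => d; rewrite -E big_nil.
- by case: (nonnil a s s1) => d; rewrite E big_nil.
have dv c u : sorted [rel m n | n %| m] (c :: u) -> all (dvdn^~ c) (c :: u).
  move=> /= p; rewrite dvdnn /=; exact: (order_path_min dtr p).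
(* Every term of a chain divides its head. At [e = c * d] both products are full, so the total
   products agree; at [e = c] the left one is full. Hence [d] times the tail product equals
   [gcdn c d] times something no larger, forcing [gcdn c d = d]. *)
have key c d u v : sorted [rel m n | n %| m] (c :: u) -> sorted [rel m n | n %| m] (d :: v) ->
    all [pred m | m > 1] (c :: u) -> all [pred m | m > 1] (d :: v) ->
    (forall e, \prod_(m <- c :: u) gcdn e m = \prod_(m <- d :: v) gcdn e m) -> d %| c.
  move=> su sv u1 v1 EE.
  have fc e : c %| e -> all (dvdn^~ e) (c :: u).
    by move=> ce; apply: sub_all (dv _ _ su) => m /dvdn_trans; apply.
  have fd e : d %| e -> all (dvdn^~ e) (d :: v).
    by move=> ce; apply: sub_all (dv _ _ sv) => m /dvdn_trans; apply.
  have := EE c; rewrite (prod_gcd_full (dv _ _ su)).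
  rewrite -(prod_gcd_full (fc (c * d) (dvdn_mulr _ (dvdnn _)))) EE.
  rewrite (prod_gcd_full (fd (c * d) (dvdn_mull _ (dvdnn _)))) !big_cons.
  case/andP: v1 => /= d1 /pos v1; case/andP: (prod_gcd_leq c v1).
  move: (\prod_(m <- v) gcdn c m) (\prod_(m <- v) m) => X Y X0 XY eq_g.
  have gd : gcdn c d <= d by apply: dvdn_leq; [exact: ltnW | exact: dvdn_gcdr].
  have dg : d = gcdn c d by nia.
  by rewrite dg dvdn_gcdl.
have ab : a = b.
  apply/eqP; rewrite eqn_dvd (key b a t s) //= ?(key a b s t) //.
rewrite -{b}ab in E t1 st *; congr (_ :: _).
case/andP: s1 => /= a1 s1; case/andP: t1 => _ t1.
apply: IH => //; [exact: path_sorted ss | exact: path_sorted st|] => d.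
have := E d; rewrite !big_cons => /eqP; rewrite eqn_pmul2l; first by move/eqP.
by rewrite gcdn_gt0 orbC ltnW.
Qed.

(** Replacing [d] by its gcd with the group order changes no torsion set, so the exponents available
    to the voters already give the counts for all [d]. *)
Lemma abelian_isog_Ldiv (gT hT : finGroupType) (G : {group gT}) (H : {group hT}) :
  abelian G -> abelian H -> #|G| = #|H| ->
  (forall d, d <= #|G| -> #|'Ldiv_d(G)%g| = #|'Ldiv_d(H)%g|) -> G \isog H.
Proof.
move=> cG cH oGH E; rewrite eq_abelian_type_isog //; apply/eqP.
have Lg (kT : finGroupType) (M : {group kT}) d :
    ('Ldiv_d(M) = 'Ldiv_(gcdn d #|M|)(M))%g.
  apply/setP => x; apply/LdivP/LdivP => -[Mx] /eqP; rewrite -order_dvdn => xd;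
    split=> //; apply/eqP; rewrite -order_dvdn.
    by rewrite dvdn_gcd xd order_dvdG.
  exact: dvdn_trans xd (dvdn_gcdl _ _).
have [b defG bG] := abelian_structure cG; have [c defH cH'] := abelian_structure cH.
apply: invariant_factors_inj; rewrite ?abelian_type_dvdn_sorted ?abelian_type_gt1 // => d.
rewrite -bG -cH' -(card_Ldiv_bigdprod d defG) -(card_Ldiv_bigdprod d defH).
rewrite Lg [in RHS]Lg -oGH E //; apply: dvdn_leq; [exact: cardG_gt0|exact: dvdn_gcdr].
Qed.

Lemma isog_card_Ldiv (gT hT : finGroupType) (G : {group gT}) (H : {group hT}) d :
  G \isog H -> #|'Ldiv_d(G)%g| = #|'Ldiv_d(H)%g|.
Proof.
case/isogP=> f injf <-; rewrite -injm_Ldiv // card_injm //; exact: subsetIl.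
Qed.

(** Solvability of [op a c = b] replaces unit and inverses, so a formula for group tables need not
    name the unit. The solution of [op x0 e = x0] is neutral everywhere because every element has
    the form [op x0 c]. *)
Lemma group_of_operation m (op : 'I_m -> 'I_m -> 'I_m) (x0 : 'I_m) :
  associative op -> commutative op -> (forall a b, exists c, op a c = b) ->
  exists (gT : finGroupType) (f : 'I_m -> gT),
    [/\ bijective f, forall a b, f (op a b) = (f a * f b)%g & abelian [set: gT]].
Proof.
move=> opA opC div.
have divP a b : exists c, op a c == b by have [c <-] := div a b; exists c.
pose e := xchoose (divP x0 x0); have ex0 : op x0 e = x0 by apply/eqP/(xchooseP (divP x0 x0)).
have e1 : left_id e op.
  by move=> a; have [c <-] := div x0 a; rewrite opA [op e _]opC ex0.
pose inv a := xchoose (divP a e).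
have invP : left_inverse e inv op.
  by move=> a; rewrite opC; apply/eqP/(xchooseP (divP a e)).
pose gT : finGroupType := HB.pack 'I_m (Finite_isGroup.Build 'I_m opA e1 invP).
exists gT, id; split=> //; first by exists id.
by apply/centsP => a _ b _; exact: opC.
Qed.

(** * The formulas for Abelian group isomorphism *)

(** Layout: 0 exponent and rank, 1 table, 2 base, 3 result, 4 order [m], 5 entry length [L], 6 to 9
    copy, exponent and two elements of a voter, 10 and above bound variables. *)
Definition nregs : nat := 20.

Definition recpred := nat -> seq bool -> (env -> bool) -> env -> bool.

Record xdefn (P : recpred) : Type := XDefn {
  xf : xform;
  xf_ok : regs_ok nregs xf;
  xfP : forall n x R e, bounded n e -> xsat n x R xf e = P n x R e
}.

Lemma xdefn_ext (P Q : recpred) :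
  (forall n x R e, bounded n e -> P n x R e = Q n x R e) -> xdefn P -> xdefn Q.
Proof. by move=> PQ [f ok fP]; exists f => // n x R e be; rewrite fP ?PQ. Qed.

Lemma xdefn_num P : defn P -> xdefn (fun n _ _ e => P n e).
Proof. by case=> f fP; exists (XNum f) => // n x R e be /=; rewrite fP. Qed.

Lemma xdefn_in j : xdefn (fun _ x _ e => nth false x (e j)).
Proof. by exists (XIn j). Qed.

Lemma xdefn_rec s :
  xdefn (fun _ _ R e => guard (e 0) (call_env s e 0) && R (call_env s e)).
Proof. by exists (XRec s). Qed.

Lemma xdefn_not P : xdefn P -> xdefn (fun n x R e => ~~ P n x R e).
Proof. by case=> f ok fP; exists (XNot f) => // n x R e be /=; rewrite fP. Qed.

Lemma xdefn_and P Q : xdefn P -> xdefn Q -> xdefn (fun n x R e => P n x R e && Q n x R e).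
Proof.
move=> [f okf fP] [g okg gP]; exists (XAnd f g) => [|n x R e be] /=; first by rewrite okf.
by rewrite fP ?gP.
Qed.

Lemma xdefn_or P Q : xdefn P -> xdefn Q -> xdefn (fun n x R e => P n x R e || Q n x R e).
Proof.
move=> [f okf fP] [g okg gP]; exists (XOr f g) => [|n x R e be] /=; first by rewrite okf.
by rewrite fP ?gP.
Qed.

Lemma xdefn_imp P Q : xdefn P -> xdefn Q -> xdefn (fun n x R e => P n x R e ==> Q n x R e).
Proof.
move=> DP DQ; apply: xdefn_ext (xdefn_or (xdefn_not DP) DQ) => n x R e _.
by rewrite implybE.
Qed.

Lemma xdefn_iff P Q : xdefn P -> xdefn Q -> xdefn (fun n x R e => P n x R e == Q n x R e).
Proof.
move=> DP DQ; apply: xdefn_ext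
  (xdefn_or (xdefn_and DP DQ) (xdefn_and (xdefn_not DP) (xdefn_not DQ))) => n x R e _.
by case: (P n x R e); case: (Q n x R e).
Qed.

Lemma xdefn_ex j P : 0 < j < nregs -> xdefn P ->
  xdefn (fun n x R e => [exists a : 'I_n.+1, P n x R (upd e j a)]).
Proof.
move=> jK [f ok fP]; exists (XEx j f) => [|n x R e be]; first by rewrite /= jK.
by rewrite /=; apply: eq_existsb => a; rewrite fP //; exact: bounded_upd.
Qed.

Lemma xdefn_all j P : 0 < j < nregs -> xdefn P ->
  xdefn (fun n x R e => [forall a : 'I_n.+1, P n x R (upd e j a)]).
Proof.
move=> jK [f ok fP]; exists (XAll j f) => [|n x R e be]; first by rewrite /= jK.
by rewrite /=; apply: eq_forallb => a; rewrite fP //; exact: bounded_upd.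
Qed.

(* Bit [l] of entry (i, j) of table [s] in an encoded pair of m x m tables whose
   entries have [L] bits. *)
Definition pos (m L s i j l : nat) : nat := 2 * m + 2 + ((s * m + i) * m + j) * L + l.

(** Lookup is a relation: a formula cannot assemble a number from input bits, but it can compare
    them with those of a candidate [k]. *)
Definition entry (n : nat) (x : seq bool) (m L s i j k : nat) : bool :=
  [&& i < m, j < m, k < m &
     [forall l : 'I_n.+1, [forall p : 'I_n.+1,
        ((l < L) && (p == pos m L s i j l :> nat)) ==> (nth false x p == bit l k)]]].

(** Registers 18 and 19 are bound inside, for the bit index and the input position, so the arguments
    must lie below them. *)
Lemma xdefn_entry s i j k : s < 18 -> i < 18 -> j < 18 -> k < 18 ->
  xdefn (fun n x _ e => entry n x (e 4) (e 5) (e s) (e i) (e j) (e k)).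
Proof.
move=> s18 i18 j18 k18.
have Dpos : tdef (fun _ e => pos (e 4) (e 5) (e s) (e i) (e j) (e 18)).
  apply: tdef_add (tdef_var 18).
  apply: tdef_add.
    by apply: tdef_add (tdef_const 2); apply: tdef_mul (tdef_const 2) (tdef_var 4).
  apply: tdef_mul (tdef_var 5); apply: tdef_add (tdef_var j).
  apply: tdef_mul (tdef_var 4); apply: tdef_add (tdef_var i).
  exact: tdef_mul (tdef_var s) (tdef_var 4).
have D := xdefn_all (isT : 0 < 18 < nregs) (xdefn_all (isT : 0 < 19 < nregs)
  (xdefn_imp (xdefn_num (defn_and (defn_lt 18 5) (defn_veq 19 Dpos)))
     (xdefn_iff (xdefn_in 19) (xdefn_num (defn_bit 18 k))))).
apply: xdefn_ext (xdefn_and (xdefn_num (defn_lt i 4)) (xdefn_and (xdefn_num (defn_lt j 4))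
  (xdefn_and (xdefn_num (defn_lt k 4)) D))) => n x R e be.
have ne r : r < 18 -> (r == 18) = false /\ (r == 19) = false by lia.
have [s1 s2] := ne s s18; have [i1 i2] := ne i i18; have [j1 j2] := ne j j18.
have [k1 k2] := ne k k18.
by rewrite /entry /upd /= ?s1 ?s2 ?i1 ?i2 ?j1 ?j2 ?k1 ?k2.
Qed.

(** For exponent 0 the result must be idempotent, which in a group singles out the unit. Exponent 2
    has its own clause because the ceiling of its square root is again 2. The three calls give
    [y = g^a], [z = y^c] and [t = g^b]; the last lookup multiplies [z] by [t]. *)
Definition power_step : recpred := fun n x R e =>
  (e 2 < e 4) &&
  [|| (e 0 == 0) && entry n x (e 4) (e 5) (e 1) (e 3) (e 3) (e 3),
      (e 0 == 1) && (e 2 == e 3),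
      (e 0 == 2) && entry n x (e 4) (e 5) (e 1) (e 2) (e 2) (e 3) |
      [exists a : 'I_n.+1, [exists c : 'I_n.+1, [exists b : 'I_n.+1,
       [exists y : 'I_n.+1, [exists z : 'I_n.+1, [exists t : 'I_n.+1,
       let e' := upd (upd (upd (upd (upd (upd e 10 a) 11 c) 12 b) 13 y) 14 z) 15 t in
       [&& e 0 == a * c + b,
           guard (e 0) a && R (call_env [:: 10; 1; 2; 13] e'),
           guard (e 0) c && R (call_env [:: 11; 1; 13; 14] e'),
           guard (e 0) b && R (call_env [:: 12; 1; 2; 15] e')
         & entry n x (e 4) (e 5) (e 1) z t (e 3)]]]]]]]].

Lemma xdefn_power_step : xdefn power_step.
Proof.
have Dab : tdef (fun _ e => e 10 * e 11 + e 12).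
  exact: tdef_add (tdef_mul (tdef_var 10) (tdef_var 11)) (tdef_var 12).
have D := xdefn_ex (isT : 0 < 10 < nregs) (xdefn_ex (isT : 0 < 11 < nregs)
  (xdefn_ex (isT : 0 < 12 < nregs) (xdefn_ex (isT : 0 < 13 < nregs)
  (xdefn_ex (isT : 0 < 14 < nregs) (xdefn_ex (isT : 0 < 15 < nregs)
  (xdefn_and (xdefn_num (defn_veq 0 Dab))
  (xdefn_and (xdefn_rec [:: 10; 1; 2; 13])
  (xdefn_and (xdefn_rec [:: 11; 1; 13; 14])
  (xdefn_and (xdefn_rec [:: 12; 1; 2; 15])
  (@xdefn_entry 1 14 15 3 isT isT isT isT)))))))))).
exact: xdefn_ext (xdefn_and (xdefn_num (defn_lt 2 4))
  (xdefn_or (xdefn_and (xdefn_num (defn_const_eq 0 0)) (@xdefn_entry 1 3 3 3 isT isT isT isT))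
  (xdefn_or (xdefn_and (xdefn_num (defn_const_eq 1 0)) (xdefn_num (defn_eq 2 3)))
  (xdefn_or (xdefn_and (xdefn_num (defn_const_eq 2 0)) (@xdefn_entry 1 2 2 3 isT isT isT isT))
    D)))).
Qed.

(** * Valid encodings and the ballots cast on them *)

Definition group_table (n : nat) (x : seq bool) (m L s : nat) : bool :=
  [&& [forall i : 'I_n.+1, [forall j : 'I_n.+1, ((i < m) && (j < m)) ==>
         [exists k : 'I_n.+1, entry n x m L s i j k]]],
      [forall i : 'I_n.+1, [forall j : 'I_n.+1, [forall k : 'I_n.+1,
         entry n x m L s i j k ==> entry n x m L s j i k]]],
      [forall i : 'I_n.+1, [forall j : 'I_n.+1, [forall k : 'I_n.+1,
       [forall a : 'I_n.+1, [forall b : 'I_n.+1, [forall c : 'I_n.+1,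
         [&& entry n x m L s i j a, entry n x m L s a k b & entry n x m L s j k c] ==>
         entry n x m L s i c b]]]]]]
    & [forall i : 'I_n.+1, [forall k : 'I_n.+1, ((i < m) && (k < m)) ==>
         [exists j : 'I_n.+1, entry n x m L s i j k]]]].

Definition valid (n : nat) (x : seq bool) (m L : nat) : bool :=
  [&& (n == 2 * m + 2 + 2 * (m * m * L)) && ((0 < m) && (L == up_log 2 m)),
      [forall p : 'I_n.+1, (p < 2 * m + 2) ==>
         (nth false x p == (p != m :> nat) && (p != 2 * m + 1 :> nat))]
    & [forall s : 'I_n.+1, (s <= 1) ==> group_table n x m L s]].

Definition killed (n : nat) (x : seq bool) (R : env -> bool) (e : env) (rs ru : nat) : bool :=
  [exists h : 'I_n.+1, (guard (e 0) (e 7) && R (call_env [:: 7; rs; ru; 12] (upd e 12 h)))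
     && entry n x (e 4) (e 5) (e rs) h h h].

(* The sides compared by copy c: (G, H) for c = 0 and 1, (G, G) for 2, (H, H) for 3. *)
Definition sides (c s1 s2 : nat) : bool := (s1 == (c == 3)) && (s2 == (c != 2)).

(** Nobody accepts an invalid encoding. On a valid one, register 0 equal to 0 marks the tie-breaker,
    which always accepts; other voters store [n] there, the largest possible rank. Comparison with
    [e 6 <= 1] negates the joint test in copies 2 and 3. *)
Definition vote : recpred := fun n x R e =>
  [exists m : 'I_n.+1, [exists L : 'I_n.+1, valid n x m L && ((e 0 == 0) ||
     [exists s1 : 'I_n.+1, [exists s2 : 'I_n.+1,
        let e' := upd (upd (upd (upd e 4 m) 5 L) 10 s1) 11 s2 in
        sides (e 6) s1 s2 &&
        ((killed n x R e' 10 8 && killed n x R e' 11 9) == (e 6 <= 1))]])]].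

Lemma xdefn_killed rs ru : (rs < 12) -> (ru < 12) ->
  xdefn (fun n x R e => killed n x R e rs ru).
Proof.
move=> rs12 ru12; have rs18 : rs < 18 by lia.
apply: xdefn_ext (xdefn_ex (isT : 0 < 12 < nregs)
  (xdefn_and (xdefn_rec [:: 7; rs; ru; 12])
    (@xdefn_entry rs 12 12 12 rs18 isT isT isT))) => n x R e be.
apply: eq_existsb => h; rewrite /upd /=.
by rewrite (_ : (rs == 12) = false) //; lia.
Qed.

Lemma xdefn_group_table : xdefn (fun n x _ e => group_table n x (e 4) (e 5) (e 1)).
Proof.
have E i j k := @xdefn_entry 1 i j k isT.
have a10 := isT : 0 < 10 < nregs; have a11 := isT : 0 < 11 < nregs.
have a12 := isT : 0 < 12 < nregs; have a13 := isT : 0 < 13 < nregs.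
have a14 := isT : 0 < 14 < nregs; have a15 := isT : 0 < 15 < nregs.
have D1 := xdefn_all a10 (xdefn_all a11
  (xdefn_imp (xdefn_num (defn_and (defn_lt 10 4) (defn_lt 11 4)))
    (xdefn_ex a12 (E 10 11 12 isT isT isT)))).
have D2 := xdefn_all a10 (xdefn_all a11 (xdefn_all a12
  (xdefn_imp (E 10 11 12 isT isT isT) (E 11 10 12 isT isT isT)))).
have D3 := xdefn_all a10 (xdefn_all a11 (xdefn_all a12 (xdefn_all a13 (xdefn_all a14
  (xdefn_all a15 (xdefn_imp (xdefn_and (E 10 11 13 isT isT isT)
    (xdefn_and (E 13 12 14 isT isT isT) (E 11 12 15 isT isT isT)))
    (E 10 15 14 isT isT isT))))))).
have D4 := xdefn_all a10 (xdefn_all a12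
  (xdefn_imp (xdefn_num (defn_and (defn_lt 10 4) (defn_lt 12 4)))
    (xdefn_ex a11 (E 10 11 12 isT isT isT)))).
exact: xdefn_ext (xdefn_and D1 (xdefn_and D2 (xdefn_and D3 D4))).
Qed.

Lemma xdefn_valid : xdefn (fun n x _ e => valid n x (e 4) (e 5)).
Proof.
have D2m2 : tdef (fun _ e => 2 * e 4 + 2).
  exact: tdef_add (tdef_mul (tdef_const 2) (tdef_var 4)) (tdef_const 2).
have D2m1 : tdef (fun _ e => 2 * e 4 + 1).
  exact: tdef_add (tdef_mul (tdef_const 2) (tdef_var 4)) (tdef_const 1).
have Dn := defn_eq_top (tdef_add D2m2 (tdef_mul (tdef_const 2)
  (tdef_mul (tdef_mul (tdef_var 4) (tdef_var 4)) (tdef_var 5)))).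
have Dh := xdefn_all (isT : 0 < 16 < nregs) (xdefn_imp (xdefn_num (defn_vlt 16 D2m2))
  (xdefn_iff (xdefn_in 16)
    (xdefn_num (defn_and (defn_not (defn_eq 16 4)) (defn_not (defn_veq 16 D2m1)))))).
have Dg := xdefn_all (isT : 0 < 1 < nregs)
  (xdefn_imp (xdefn_num (defn_vle 1 (tdef_const 1))) xdefn_group_table).
exact: xdefn_ext (xdefn_and (xdefn_num (defn_and Dn (defn_up_log 4 5))) (xdefn_and Dh Dg)).
Qed.

Lemma defn_sides c s1 s2 : defn (fun _ e => sides (e c) (e s1) (e s2)).
Proof.
apply: defn_ext (defn_and
  (defn_if (defn_const_eq 3 c) (defn_const_eq 1 s1) (defn_const_eq 0 s1))
  (defn_if (defn_const_eq 2 c) (defn_const_eq 0 s2) (defn_const_eq 1 s2))) => n e _.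
by rewrite /sides; case: (e c == 3); case: (e c == 2).
Qed.

Lemma xdefn_vote : xdefn vote.
Proof.
have Dt := xdefn_ex (isT : 0 < 10 < nregs) (xdefn_ex (isT : 0 < 11 < nregs)
  (xdefn_and (xdefn_num (defn_sides 6 10 11))
  (xdefn_iff (xdefn_and (@xdefn_killed 10 8 isT isT) (@xdefn_killed 11 9 isT isT))
    (xdefn_num (defn_vle 6 (tdef_const 1)))))).
exact: xdefn_ext (xdefn_ex (isT : 0 < 4 < nregs) (xdefn_ex (isT : 0 < 5 < nregs)
  (xdefn_and xdefn_valid (xdefn_or (xdefn_num (defn_const_eq 0 0)) Dt)))).
Qed.

(* The voters: one for each (c, d, u, v) with c <= 3, and the null tuple breaking ties. *)
Definition voter (n : nat) (e : env) : bool :=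
  all (fun r => e r == 0) ([:: 1; 2; 3; 4; 5] ++ iota 10 10) &&
  ((e 0 == n) && (e 6 <= 3) || all (fun r => e r == 0) [:: 0; 6; 7; 8; 9]).

Lemma defn_voter : defn voter.
Proof.
apply: defn_and.
  by apply: (@defn_seq_all _ _ (fun r _ e => e r == 0)) => r; exact: defn_const_eq.
apply: defn_or.
  exact: defn_and (defn_top 0) (defn_vle 6 (tdef_const 3)).
by apply: (@defn_seq_all _ _ (fun r _ e => e r == 0)) => r; exact: defn_const_eq.
Qed.

(** * Encodings *)

Lemma bit0E a : bit 0 a = odd a.
Proof. by rewrite /bit divn1. Qed.

Lemma bitS l a : bit l.+1 a = bit l a./2.
Proof. by rewrite /bit expnS divnMA divn2. Qed.

Lemma eq_bits L a b : a < 2 ^ L -> b < 2 ^ L ->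
  (forall l, l < L -> bit l a = bit l b) -> a = b.
Proof.
elim: L a b => [|L IH] a b; first by rewrite expn0; lia.
rewrite expnS => aL bL E; have := E 0 isT; rewrite !bit0E => oab.
rewrite -[a]odd_double_half -[b]odd_double_half oab; congr (_ + _.*2).
by apply: IH => [||l lL]; [lia|lia|rewrite -!bitS E].
Qed.

Lemma nth_flatten_uniform (A : Type) (x0 : A) L (ss : seq (seq A)) q l :
  all (fun s => size s == L) ss -> q < size ss -> l < L ->
  nth x0 (flatten ss) (q * L + l) = nth x0 (nth [::] ss q) l.
Proof.
elim: ss q => [|s ss IH] [|q] //= /andP[/eqP sL al] qs lL; rewrite nth_cat sL.
  by rewrite mul0n add0n lL.
have -> : q.+1 * L + l < L = false by lia.
by rewrite -(IH q) //; congr nth; lia.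
Qed.

Lemma size_flatten_uniform (A : Type) L (ss : seq (seq A)) :
  all (fun s => size s == L) ss -> size (flatten ss) = size ss * L.
Proof.
by elim: ss => [|s ss IH] //= /andP[/eqP sL al]; rewrite size_cat sL IH // mulSn.
Qed.

Lemma encode_table_blocks m (T : 'M['I_m]_m) :
  let bs := [seq binary (up_log 2 m) (T i j) | i <- enum 'I_m, j <- enum 'I_m] in
  [/\ all (fun s => size s == up_log 2 m) bs, size bs = m * m
    & forall i j : 'I_m, nth [::] bs (i * m + j) = binary (up_log 2 m) (T i j)].
Proof.
move=> bs; split.
- apply/allP => s /allpairsPdep[i [j [_ _ ->]]].
  by rewrite size_map size_iota.
- by rewrite size_allpairs -!cardE card_ord.
move=> i j; rewrite /bs nth_flatten_uniform; first last.
- exact: ltn_ord.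
- by rewrite size_map -cardE card_ord.
- by apply/allP => s /mapP[k _ ->]; rewrite size_map -cardE card_ord.
rewrite (nth_map i) -?cardE ?card_ord // nth_ord_enum.
by rewrite (nth_map j) -?cardE ?card_ord // nth_ord_enum.
Qed.

Lemma size_encode_table m (T : 'M['I_m]_m) : size (encode_table T) = m * m * up_log 2 m.
Proof.
have [al sz _] := encode_table_blocks T.
by rewrite (size_flatten_uniform al) sz.
Qed.

Lemma nth_encode_table m (T : 'M['I_m]_m) (i j : 'I_m) l : l < up_log 2 m ->
  nth false (encode_table T) ((i * m + j) * up_log 2 m + l) = bit l (T i j).
Proof.
move=> lL; have [al sz nE] := encode_table_blocks T.
rewrite nth_flatten_uniform // ?sz; last by have := ltn_ord i; have := ltn_ord j; nia.
by rewrite nE (nth_map 0) ?size_iota // nth_iota.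
Qed.

Lemma size_encode_pair m (T U : 'M['I_m]_m) :
  size (encode_pair T U) = 2 * m + 2 + 2 * (m * m * up_log 2 m).
Proof.
rewrite /encode_pair size_cat /= !size_cat /= !size_cat !size_nseq !size_encode_table.
by lia.
Qed.

Lemma nth_encode_head m (T U : 'M['I_m]_m) p : p < 2 * m + 2 ->
  nth false (encode_pair T U) p = (p != m) && (p != 2 * m + 1).
Proof.
move=> pm; rewrite /encode_pair nth_cat size_nseq; case: ltnP => p1.
  by rewrite nth_nseq p1; lia.
have [->|p2] := eqVneq p m; first by rewrite subnn.
have [q pE] : exists q, p = m + q.+1 by exists (p - m).-1; lia.
rewrite {}pE in pm p1 p2 *.
rewrite addKn /= nth_cat size_nseq; case: ltnP => qm.
  by rewrite nth_nseq qm; lia.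
have -> : q - m = 0 by lia.
rewrite /=; lia.
Qed.

Lemma nth_encode_pos m (T U : 'M['I_m]_m) (s l : nat) (i j : 'I_m) :
  s <= 1 -> l < up_log 2 m ->
  nth false (encode_pair T U) (pos m (up_log 2 m) s i j l) =
  bit l ((if s == 0 then T else U) i j).
Proof.
move=> s1 lL; set L := up_log 2 m; rewrite /pos /encode_pair.
rewrite -cat1s -[false :: encode_table T ++ _]cat1s !catA.
have sh : size (((nseq m true ++ [:: false]) ++ nseq m true) ++ [:: false]) = 2 * m + 2.
  by rewrite !size_cat !size_nseq /=; lia.
rewrite -catA nth_cat sh.
have -> : 2 * m + 2 + ((s * m + i) * m + j) * L + l < 2 * m + 2 = false by lia.
have -> : 2 * m + 2 + ((s * m + i) * m + j) * L + l - (2 * m + 2) =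
   ((s * m + i) * m + j) * L + l by lia.
rewrite nth_cat size_encode_table -/L.
have im := ltn_ord i; have jm := ltn_ord j.
case: s s1 => [|[|//]] _ /=.
  have -> : ((0 * m + i) * m + j) * L + l < m * m * L.
    have ij : i * m + j < m * m by nia.
    by rewrite mul0n add0n; move: (i * m + j) (m * m) ij => A B; nia.
  by rewrite mul0n add0n nth_encode_table.
have -> : ((1 * m + i) * m + j) * L + l = m * m * L + ((i * m + j) * L + l) by lia.
by rewrite ltnNge leq_addr /= addKn nth_encode_table.
Qed.

Lemma pos_lt m L s i j l : s <= 1 -> i < m -> j < m -> l < L ->
  pos m L s i j l < 2 * m + 2 + 2 * (m * m * L).
Proof.
move=> s1 im jm lL; rewrite /pos -addnA ltn_add2l mulnA.
have sm : s * m + i < 2 * m by nia.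
have sj : (s * m + i) * m + j < 2 * m * m by nia.
by rewrite mulnA; move: ((s * m + i) * m + j) (2 * m * m) sj => A B; nia.
Qed.

(** A position after the header is a mixed-radix number whose digits are recovered by repeated
    division, so no bit escapes the tables. *)
Lemma pos_surj m L p : 2 * m + 2 <= p < 2 * m + 2 + 2 * (m * m * L) ->
  exists s i j l, [/\ s <= 1, i < m, j < m, l < L & p = pos m L s i j l].
Proof.
case/andP=> p1 p2; have mmL : 0 < m * m * L by lia.
have m0 : 0 < m by case: (m) mmL.
have L0 : 0 < L by case: (L) mmL => //; rewrite muln0.
pose q := p - (2 * m + 2); pose a := q %/ L %/ m.
exists (a %/ m), (a %% m), (q %/ L %% m), (q %% L); rewrite !ltn_mod m0 L0; split=> //.
  rewrite -ltnS ltn_divLR // ltn_divLR // ltn_divLR // /q.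
  by rewrite (_ : 2 * m * m * L = 2 * (m * m * L)); lia.
rewrite /pos -divn_eq -divn_eq -addnA -divn_eq /q; lia.
Qed.

(** Both numbers are below [m], hence below [2 ^ L], so agreement on [L] bits is equality; the
    positions tested all lie inside the universe. *)
Lemma entry_eqE n x m L s (T : nat -> nat -> nat) :
  n = 2 * m + 2 + 2 * (m * m * L) -> L = up_log 2 m -> s <= 1 ->
  (forall i j, i < m -> j < m -> T i j < m) ->
  (forall i j l, i < m -> j < m -> l < L ->
     nth false x (pos m L s i j l) = bit l (T i j)) ->
  forall i j k, entry n x m L s i j k = [&& i < m, j < m, k < m & T i j == k].
Proof.
move=> nE LE s1 Tm xT i j k; rewrite /entry.
case im: (i < m) => //=; case jm: (j < m) => //=; case km: (k < m) => //=.
have m2L a : a < m -> a < 2 ^ L by move=> am; rewrite LE (leq_trans am) // up_logP.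
apply/forallP/eqP => [H|<- l].
  apply: (@eq_bits L); rewrite ?m2L ?Tm // => l lL.
  have pn : pos m L s i j l < n.+1 by rewrite ltnW // ltnS nE pos_lt.
  have ln : l < n.+1 by apply: leq_ltn_trans pn; rewrite /pos leq_addl.
  have /forallP/(_ (Ordinal pn)) := H (Ordinal ln); rewrite /= lL eqxx xT //=.
  by move/eqP.
by apply/forallP => p; apply/implyP => /andP[lL /eqP->]; rewrite xT.
Qed.

(** * Tables of groups *)

(* [f] reads off a group of order [m] from table [s] of the input. *)
Record reads (gT : finGroupType) (n : nat) (x : seq bool) (m L s : nat)
    (f : nat -> gT) : Prop := Reads {
  reads_inj : forall i j, i < m -> j < m -> f i = f j -> i = j;
  reads_surj : forall g, exists2 i, i < m & f i = g;
  reads_entry : forall i j k, entry n x m L s i j k =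
    [&& i < m, j < m, k < m & (f i * f j)%g == f k]
}.

Lemma reads_cayley (gT : finGroupType) n x m L s (T : 'M['I_m]_m) :
  n = 2 * m + 2 + 2 * (m * m * L) -> L = up_log 2 m -> s <= 1 ->
  is_cayley_table gT T ->
  (forall (i j : 'I_m) l, l < L -> nth false x (pos m L s i j l) = bit l (T i j)) ->
  exists f : nat -> gT, reads n x m L s f.
Proof.
move=> nE LE s1 [e [[e' eK e'K] eM]] xT.
have m0 : 0 < m by exact: leq_ltn_trans (leq0n _) (ltn_ord (e' 1%g)).
pose o i : 'I_m := insubd (Ordinal m0) i.
have oE i : i < m -> o i = i :> nat by move=> im; rewrite val_insubd im.
have oK (i : 'I_m) : o i = i by apply: val_inj; rewrite /= oE.
exists (fun i => e (o i)); split.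
- move=> i j im jm /(can_inj eK) /(congr1 val) /=; by rewrite !oE.
- by move=> g; exists (e' g) => //; rewrite oK e'K.
move=> i j k; rewrite (@entry_eqE n x m L s (fun i j => T (o i) (o j)) nE LE s1) //; last first.
  by move=> i' j' l im jm lL; rewrite -xT // !oE.
case im: (i < m) => //=; case jm: (j < m) => //=; case km: (k < m) => //=.
rewrite -eM (inj_eq (can_inj eK)) -val_eqE /= oE //.
Qed.

Lemma reads_group_table (gT : finGroupType) n x m L s (f : nat -> gT) :
  m <= n -> reads n x m L s f -> abelian [set: gT] -> group_table n x m L s.
Proof.
move=> mn [f_inj f_surj fE] cG.
have cgg (a b : gT) : (a * b = b * a)%g by apply: (centsP cG); rewrite inE.
have pick g : exists2 i : 'I_n.+1, i < m & f i = g.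
  have [i im <-] := f_surj g; have il : i < n.+1 by lia.
  by exists (Ordinal il).
apply/and4P; split.
- apply/forallP => i; apply/forallP => j; apply/implyP => /andP[im jm].
  by have [k km kE] := pick (f i * f j)%g; apply/existsP; exists k; rewrite fE im jm km kE /=.
- apply/forallP => i; apply/forallP => j; apply/forallP => k; apply/implyP.
  by rewrite !fE => /and4P[-> -> -> /eqP <-]; rewrite cgg eqxx.
- do 6![apply/forallP => ?]; apply/implyP; rewrite !fE.
  case/and3P=> /and4P[im jm am /eqP aE] /and4P[_ km bm /eqP bE] /and4P[_ _ cm /eqP cE].
  by rewrite im bm cm -bE -cE -aE mulgA eqxx.
apply/forallP => i; apply/forallP => k; apply/implyP => /andP[im km].
have [j jm jE] := pick ((f i)^-1 * f k)%g; apply/existsP; exists j.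
by rewrite fE im jm km jE mulKVg /=.
Qed.

Lemma valid_encode (gT hT : finGroupType) m (T U : 'M['I_m]_m) :
  is_cayley_table gT T -> is_cayley_table hT U ->
  abelian [set: gT] -> abelian [set: hT] ->
  let x := encode_pair T U in
  let n := size x in
  valid n x m (up_log 2 m) /\
  exists (f : nat -> gT) (g : nat -> hT),
    reads n x m (up_log 2 m) 0 f /\ reads n x m (up_log 2 m) 1 g.
Proof.
move=> cT cU aG aH x n; have nE : n = _ := size_encode_pair T U.
have [f fP] := @reads_cayley gT n x m _ 0 T nE erefl isT cT
  (fun i j l => @nth_encode_pos m T U 0 l i j isT).
have [g gP] := @reads_cayley hT n x m _ 1 U nE erefl isT cU
  (fun i j l => @nth_encode_pos m T U 1 l i j isT).
split; last by exists f, g.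
have mn : m <= n by lia.
have m0 : 0 < m.
  by case: cT => e [[e' _ _] _]; exact: leq_ltn_trans (leq0n _) (ltn_ord (e' 1%g)).
apply/and3P; split; first by rewrite -nE m0 !eqxx.
  apply/forallP => p; apply/implyP => pm.
  by rewrite nth_encode_head.
apply/forallP => -[[|[|s]] sn] //=.
  exact: reads_group_table fP aG.
exact: reads_group_table gP aH.
Qed.

Lemma table_of_valid n x m L s : m <= n -> 0 < m -> n = 2 * m + 2 + 2 * (m * m * L) ->
  L = up_log 2 m -> s <= 1 ->
  group_table n x m L s ->
  exists (gT : finGroupType) (T : 'M['I_m]_m),
    [/\ is_cayley_table gT T, abelian [set: gT] &
        forall (i j : 'I_m) l, l < L -> nth false x (pos m L s i j l) = bit l (T i j)].
Proof.
move=> mn m0 nE LE s1 /and4P[tot com ass div].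
have wd (i : 'I_m) : i < n.+1 by have := ltn_ord i; lia.
pose w (i : 'I_m) : 'I_n.+1 := Ordinal (wd i).
have totE (i j : 'I_m) : exists k : 'I_m, entry n x m L s i j k.
  have /forallP/(_ (w j)) := forallP tot (w i); rewrite /= !ltn_ord /=.
  case/existsP=> k ek; have km : k < m by case/and4P: ek.
  by exists (Ordinal km).
pose op i j := xchoose (totE i j); have opP i j := xchooseP (totE i j).
have xop (i j : 'I_m) l : l < L -> nth false x (pos m L s i j l) = bit l (op i j).
  move=> lL; have /and4P[_ _ _ /forallP H] := opP i j.
  have pn : pos m L s i j l < n.+1 by rewrite ltnW // ltnS nE pos_lt.
  have ln : l < n.+1 by apply: leq_ltn_trans pn; rewrite /pos leq_addl.
  by have /forallP/(_ (Ordinal pn)) := H (Ordinal ln); rewrite /= lL eqxx /= => /eqP.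
pose z : 'I_m := Ordinal m0; pose o i : 'I_m := insubd z i.
have oK (i : 'I_m) : o i = i by apply: val_inj; rewrite /= val_insubd ltn_ord.
have oE i : i < m -> o i = i :> nat by move=> im; rewrite val_insubd im.
have eE (i j k : 'I_m) : entry n x m L s i j k = (op i j == k).
  rewrite (@entry_eqE n x m L s (fun i j => op (o i) (o j)) nE LE s1) //.
    by rewrite !ltn_ord /= !oK.
  by move=> a b l am bm lL; rewrite -xop // !oE.
have opC : commutative op.
  move=> i j; have /forallP/(_ (w j))/forallP/(_ (w (op i j))) := forallP com (w i).
  by rewrite /= !eE eqxx => /eqP.
have opA : associative op.
  move=> i j k; have /forallP/(_ (w j))/forallP/(_ (w k)) := forallP ass (w i).
  move/forallP/(_ (w (op i j)))/forallP/(_ (w (op (op i j) k)))/forallP/(_ (w (op j k))).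
  by rewrite /= !eE !eqxx => /eqP.
have opD i k : exists j, op i j = k.
  have /forallP/(_ (w k)) := forallP div (w i); rewrite /= !ltn_ord /=.
  case/existsP=> j ej; have jm : j < m by case/and4P: ej.
  by exists (Ordinal jm); apply/eqP; rewrite -eE.
have [gT [f [fb fM aG]]] := group_of_operation z opA opC opD.
exists gT, (\matrix_(i, j) op i j)%R; split=> //; last by move=> i j l lL; rewrite mxE xop.
by exists f; split=> // i j; rewrite mxE fM.
Qed.

(** Length, header and table bits together fix every position of [x], so the tables read off encode
    back to [x]. *)
Lemma valid_decode n x m L : size x = n -> valid n x m L ->
  exists (gT hT : finGroupType) (T U : 'M['I_m]_m),
    [/\ is_cayley_table gT T, is_cayley_table hT U, x = encode_pair T U
      & abelian [set: gT] /\ abelian [set: hT]].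
Proof.
move=> xn /and3P[/andP[/eqP nE /andP[m0 /eqP LE]] /forallP hd /forallP grp].
have mn : m <= n by lia.
have n0 : 0 < n.+1 by []. have n1 : 1 < n.+1 by lia.
have [gT [T [cT aG xT]]] := table_of_valid mn m0 nE LE (isT : 0 <= 1) (grp (Ordinal n0)).
have [hT [U [cU aH xU]]] := table_of_valid mn m0 nE LE (isT : 1 <= 1) (grp (Ordinal n1)).
exists gT, hT, T, U; split=> //.
have szE : size x = size (encode_pair T U) by rewrite size_encode_pair -LE -nE.
apply: (@eq_from_nth _ false) => // p; rewrite xn => pn.
have [pm|pm] := ltnP p (2 * m + 2).
  have pn' : p < n.+1 by exact: ltnW.
  by rewrite nth_encode_head //; have /implyP/(_ pm)/eqP := hd (Ordinal pn').
have [|s [i [j [l [s1 im jm lL ->]]]]] := @pos_surj m L p; first by rewrite pm -nE.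
rewrite -[i]/(val (Ordinal im)) -[j]/(val (Ordinal jm)) [in RHS]LE.
rewrite nth_encode_pos -?LE //.
by case: s s1 => [|[|//]] _; [rewrite xT|rewrite xU].
Qed.

(** The length grows strictly with the order, so the [m] guessed inside a vote is unique. *)
Lemma order_inj m m' : 2 * m + 2 + 2 * (m * m * up_log 2 m) =
  2 * m' + 2 + 2 * (m' * m' * up_log 2 m') -> m = m'.
Proof.
wlog le : m m' / m <= m' => [H E|].
  by have [/H|/ltnW/H] := leqP m m'; [exact|move/(_ (esym E))].
have := leq_mul (leq_mul le le) (leq_up_log 2 le).
by lia.
Qed.

(** * Powers *)

Lemma guard_lt i j : guard i j -> j < i.
Proof. by case/andP=> i2 ji; rewrite ltnNge; apply/negP => ij; nia. Qed.

(** Divide by the least [c] with [i <= c * c]: minimality is the guard for [c], and quotient and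
    remainder are at most [c]. *)
Lemma ceil_sqrt_split i : 2 < i ->
  exists a c b, [/\ i = a * c + b, guard i a, guard i c & guard i b].
Proof.
move=> i2; have ex : exists c, i <= c * c by exists i; nia.
case: (ex_minnP ex) => c ic cmin.
have c0 : 0 < c by lia.
have gc : guard i c.
  rewrite /guard i2 ltnNge; apply/negP => /cmin; lia.
have ge a : a <= c -> guard i a.
  move=> ac; case/andP: gc => _ gc; rewrite /guard i2 /=; apply: leq_ltn_trans gc.
  by apply: leq_mul; lia.
exists (i %/ c), c, (i %% c); split=> //; first exact: divn_eq.
  by apply: ge; rewrite -[leqRHS](mulnK c c0) leq_div2r.
by apply: ge; rewrite ltnW // ltn_mod.
Qed.

Section Powers.
Variables (gT : finGroupType) (n : nat) (x : seq bool) (R : env -> bool) (m L s : nat).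
Variable f : nat -> gT.
Hypotheses (m_le_n : m <= n) (f_reads : reads n x m L s f).

Definition at_side (e : env) : Prop := [/\ bounded n e, e 1 = s, e 4 = m & e 5 = L].

Definition power_of (i g h : nat) : bool := [&& g < m, h < m & (f g ^+ i)%g == f h].

Lemma reads_pick (g : gT) : exists2 i : 'I_n.+1, i < m & f i = g.
Proof.
have [i im <-] := reads_surj f_reads g; have il : i < n.+1 by lia.
by exists (Ordinal il).
Qed.

Lemma power_step_spec e : at_side e ->
  (forall e', at_side e' -> e' 0 < e 0 -> R e' = power_of (e' 0) (e' 2) (e' 3)) ->
  power_step n x R e = power_of (e 0) (e 2) (e 3).
Proof.
move=> [be e1 e4 e5] IH; rewrite /power_step /power_of e1 e4 e5.
case gm: (e 2 < m) => //=.
have entE := reads_entry f_reads.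
have [i2|i2] := leqP (e 0) 2.
  (* Every guard fails for exponents up to 2, so only the base clauses remain. *)
  rewrite [X in _ || (_ || (_ || X))](_ : _ = false) ?orbF; last first.
    apply/negbTE/negP; do 6![case/existsP => ?].
    by rewrite /guard ltnNge i2 /= andbF.
  rewrite !entE gm; case: (e 0) i2 => [|[|[|//]]] _ /=; rewrite ?orbF.
  - rewrite expg0; case: (e 3 < m) => //=.
    by rewrite -[X in _ == X]mulg1 (inj_eq (mulgI _)) eq_sym.
  - rewrite expg1; apply/eqP/andP => [<-|[hm /eqP gh]]; first by rewrite gm eqxx.
    exact: (reads_inj f_reads).
  by rewrite expgS expg1.
have [i0 i1] : 0 < e 0 /\ 1 < e 0 by lia.
rewrite (gtn_eqF i0) (gtn_eqF i1) (gtn_eqF i2) /=.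
pose ext (a c b y z t : 'I_n.+1) : env :=
  upd (upd (upd (upd (upd (upd e 10 a) 11 c) 12 b) 13 y) 14 z) 15 t.
have side l a c b y z t : nth 1 l 1 = 1 -> nth 4 l 4 = 4 -> nth 5 l 5 = 5 ->
    at_side (call_env l (ext a c b y z t)).
  move=> l1 l4 l5; split; rewrite /call_env ?l1 ?l4 ?l5 // => r.
  by do 6![apply: bounded_upd].
have Ra (a c b y z t : 'I_n.+1) : guard (e 0) a ->
    R (call_env [:: 10; 1; 2; 13] (ext a c b y z t)) = power_of a (e 2) y.
  by move=> /guard_lt ga; rewrite IH //; exact: side.
have Rc (a c b y z t : 'I_n.+1) : guard (e 0) c ->
    R (call_env [:: 11; 1; 13; 14] (ext a c b y z t)) = power_of c y z.
  by move=> /guard_lt ga; rewrite IH //; exact: side.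
have Rb (a c b y z t : 'I_n.+1) : guard (e 0) b ->
    R (call_env [:: 12; 1; 2; 15] (ext a c b y z t)) = power_of b (e 2) t.
  by move=> /guard_lt ga; rewrite IH //; exact: side.
apply/idP/andP => [|[hm /eqP gh]].
  case/existsP=> a /existsP[c /existsP[b /existsP[y /existsP[z /existsP[t]]]]].
  case/and5P=> /eqP iE /andP[ga +] /andP[gc +] /andP[gb +].
  rewrite Ra // Rc // Rb //.
  case/and3P=> _ ym /eqP yE /and3P[_ zm /eqP zE] /and3P[_ tm /eqP tE].
  rewrite entE => /and4P[_ _ hm /eqP hE]; split=> //; apply/eqP.
  by rewrite iE expgD expgM yE zE tE.
have [a [c [b [iE ga gc gb]]]] := ceil_sqrt_split i2.
have le_n j : guard (e 0) j -> j < n.+1 by move/guard_lt => ji; have := be 0; lia.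
have [y ym yE] := reads_pick (f (e 2) ^+ a)%g.
have [z zm zE] := reads_pick (f y ^+ c)%g.
have [t tm tE] := reads_pick (f (e 2) ^+ b)%g.
apply/existsP; exists (Ordinal (le_n a ga)); apply/existsP; exists (Ordinal (le_n c gc)).
apply/existsP; exists (Ordinal (le_n b gb)); apply/existsP; exists y.
apply/existsP; exists z; apply/existsP; exists t.
rewrite Ra // Rc // Rb // /power_of ga gc gb gm ym zm tm entE zm tm hm /=.
by rewrite zE tE yE !eqxx -iE -expgM -expgD -iE gh !eqxx.
Qed.

Hypothesis R_rec : forall e, bounded n e -> R e = power_step n x R (normal nregs e).

Lemma R_power e : at_side e -> R e = power_of (e 0) (e 2) (e 3).
Proof.
have [i] := ubnP (e 0); elim: i e => // i IH e ei [be e1 e4 e5].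
rewrite R_rec // power_step_spec //; first by split=> // r; exact: be.
by move=> e' ae' e'e; apply: IH => //; apply: leq_trans e'e _.
Qed.

Lemma killedE e rs ru : bounded n e -> e rs = s -> e 4 = m -> e 5 = L ->
  (rs < 12) -> (ru < 12) ->
  killed n x R e rs ru =
  [&& guard (e 0) (e 7), e ru < m & (f (e ru) ^+ e 7)%g == 1%g].
Proof.
move=> be es e4 e5 rs12 ru12; rewrite /killed.
have RE (h : 'I_n.+1) : R (call_env [:: 7; rs; ru; 12] (upd e 12 h)) =
    power_of (e 7) (e ru) h.
  have rsN : (rs == 12) = false by lia.
  have ruN : (ru == 12) = false by lia.
  rewrite R_power; first by rewrite /call_env /upd /= ruN.
  split; rewrite /call_env /upd /= ?rsN // => r.
  by rewrite -/(upd e 12 h _); exact: bounded_upd.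
apply/existsP/and3P => [[h]|[gd um /eqP k1]].
  rewrite RE es e4 e5 (reads_entry f_reads) => /andP[/andP[-> /and3P[-> _ /eqP->]]].
  case/and4P=> _ _ _; rewrite -[X in _ == X]mulg1 (inj_eq (mulgI _)) => /eqP->.
  by rewrite eqxx.
have [h hm hE] := reads_pick 1%g; exists h.
rewrite RE gd /power_of um hm k1 hE eqxx /= es e4 e5 (reads_entry f_reads) hm hE.
by rewrite mulg1 eqxx.
Qed.

(** The guard mirrors the one in [killed]: an exponent that fails it gives the empty set for both
    groups and cannot disturb the comparison. *)
Definition torsion (d : nat) : {set 'I_n.+1} :=
  [set u : 'I_n.+1 | [&& guard n d, u < m & (f u ^+ d)%g == 1%g]].

Lemma card_torsion d : guard n d -> #|torsion d| = #|'Ldiv_d([set: gT])%g|.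
Proof.
move=> gd; rewrite -(card_in_imset (f := fun u : 'I_n.+1 => f u)).
  apply: eq_card => g; apply/imsetP/LdivP => [[u]|[_ g1]].
    by rewrite inE => /and3P[_ _ /eqP u1] ->; split; rewrite ?inE.
  by have [u um uE] := reads_pick g; exists u; rewrite // inE gd um uE g1 /=.
move=> u v; rewrite !inE => /and3P[_ um _] /and3P[_ vm _] uv.
by apply: val_inj; exact: (reads_inj f_reads).
Qed.

End Powers.

(** * The majority vote *)

Lemma card_set_pair (X Y : finType) (P : X -> Y -> bool) :
  #|[set p : X * Y | P p.1 p.2]| = \sum_a #|[set b | P a b]|.
Proof.
rewrite -sum1_card (eq_bigl (fun p : X * Y => true && P p.1 p.2)); last first.
  by move=> p; rewrite inE.
rewrite -(pair_big_dep predT P (fun _ _ => 1)) /=; apply: eq_bigr => a _.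
by rewrite sum1_card; apply: eq_card => b; rewrite !inE.
Qed.

Lemma card_setX_pred (X Y : finType) (A : {set X}) (B : {set Y}) :
  #|[set p : X * Y | (p.1 \in A) && (p.2 \in B)]| = #|A| * #|B|.
Proof. by rewrite -cardsX; apply: eq_card => p; rewrite !inE. Qed.

Lemma card_setX_compl (X Y : finType) (A : {set X}) (B : {set Y}) :
  #|[set p : X * Y | ~~ ((p.1 \in A) && (p.2 \in B))]| = #|X| * #|Y| - #|A| * #|B|.
Proof.
rewrite cardsCs card_prod -card_setX_pred; congr (_ - _).
by apply: eq_card => p; rewrite !inE negbK.
Qed.

(** The left side is [2 * (M * M)] minus the square of the difference; the bounds on [a] and [b]
    make the truncated subtractions exact. *)
Lemma square_gap M a b : a <= M -> b <= M ->
  2 * (a * b) + (M * M - a * a) + (M * M - b * b) <= 2 * (M * M) ?= iff (a == b).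
Proof.
move=> aM bM; have a2 := leq_mul aM aM; have b2 := leq_mul bM bM.
have [->|ab] := eqVneq a b; first by split; [|apply/eqP]; lia.
have lt : 2 * (a * b) < a * a + b * b.
  by case: (ltngtP a b) ab => // h _; nia.
by split; [|apply/eqP]; lia.
Qed.

(** * Counting the votes on a valid input *)

Section Vote.
Variables (gT hT : finGroupType) (n : nat) (x : seq bool) (R : env -> bool) (m L : nat).
Variables (f : nat -> gT) (g : nat -> hT).
Hypotheses (x_valid : valid n x m L) (L_len : L = up_log 2 m).
Hypotheses (f_reads : reads n x m L 0 f) (g_reads : reads n x m L 1 g).
Hypothesis R_rec : forall e, bounded n e -> R e = power_step n x R (normal nregs e).

Lemma valid_length : n = 2 * m + 2 + 2 * (m * m * L) /\ 0 < m.
Proof. by case/and3P: x_valid => /andP[/eqP nE /andP[m0 _]] _ _. Qed.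

Lemma valid_unique m' L' : valid n x m' L' -> m' = m /\ L' = L.
Proof.
case/and3P=> /andP[/eqP nE' /andP[_ /eqP LE']] _ _.
have [nE _] := valid_length.
have mm : m' = m by apply: order_inj; rewrite -LE' -nE' nE L_len.
by rewrite LE' L_len mm.
Qed.

Let m_le_n : m <= n. Proof. by have [nE _] := valid_length; lia. Qed.

Local Notation A := (torsion n m f).
Local Notation B := (torsion n m g).

Definition ballot (c : nat) (d : nat) (u v : 'I_n.+1) : bool :=
  if c <= 1 then (u \in A d) && (v \in B d)
  else if c == 2 then ~~ ((u \in A d) && (v \in A d))
  else ~~ ((u \in B d) && (v \in B d)).

Lemma voteE e (u v : 'I_n.+1) : bounded n e -> e 8 = u -> e 9 = v -> e 6 <= 3 ->
  e 0 = n -> vote n x R e = ballot (e 6) (e 7) u v.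
Proof.
move=> be e8 e9 e6 e0; have [nE m0] := valid_length.
have n0 : (e 0 == 0) = false by lia.
pose ext (m L s1 s2 : 'I_n.+1) : env := upd (upd (upd (upd e 4 m) 5 L) 10 s1) 11 s2.
have kill (k1 k2 s1 s2 : 'I_n.+1) : k1 = m :> nat -> k2 = L :> nat ->
    ((s1 = 0 :> nat -> killed n x R (ext k1 k2 s1 s2) 10 8 = (u \in A (e 7))) *
     (s1 = 1 :> nat -> killed n x R (ext k1 k2 s1 s2) 10 8 = (u \in B (e 7))) *
     (s2 = 0 :> nat -> killed n x R (ext k1 k2 s1 s2) 11 9 = (v \in A (e 7))) *
     (s2 = 1 :> nat -> killed n x R (ext k1 k2 s1 s2) 11 9 = (v \in B (e 7))))%type.
  move=> km kL; have bx : bounded n (ext k1 k2 s1 s2) by do 4![apply: bounded_upd].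
  split; first split; first split; move=> sE; rewrite !inE.
  - by rewrite (killedE m_le_n f_reads R_rec) // /ext /upd /= e0 e8.
  - by rewrite (killedE m_le_n g_reads R_rec) // /ext /upd /= e0 e8.
  - by rewrite (killedE m_le_n f_reads R_rec) // /ext /upd /= e0 e9.
  - by rewrite (killedE m_le_n g_reads R_rec) // /ext /upd /= e0 e9.
have mn : m < n.+1 by []. have LmL : L <= m * m * L by apply: leq_pmull; rewrite muln_gt0 m0.
have Ln : L < n.+1 by lia.
have n1 : 1 < n.+1 by lia.
have tests (k1 k2 : 'I_n.+1) : k1 = m :> nat -> k2 = L :> nat ->
    [exists s1 : 'I_n.+1, [exists s2 : 'I_n.+1, sides (e 6) s1 s2 &&
        ((killed n x R (ext k1 k2 s1 s2) 10 8 && killed n x R (ext k1 k2 s1 s2) 11 9)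
          == (e 6 <= 1))]] = ballot (e 6) (e 7) u v.
  move=> km kL; have K s1 s2 := kill k1 k2 s1 s2 km kL.
  have sE (s1 s2 : nat) (p1 : s1 < n.+1) (p2 : s2 < n.+1) (P : 'I_n.+1 -> 'I_n.+1 -> bool) :
      (forall t1 t2, sides (e 6) t1 t2 = (t1 == s1) && (t2 == s2)) ->
      [exists t1 : 'I_n.+1, [exists t2 : 'I_n.+1, sides (e 6) t1 t2 && P t1 t2]] =
      P (Ordinal p1) (Ordinal p2).
    move=> sP; apply/existsP/idP => [[t1 /existsP[t2]]|Pt].
      rewrite sP => /andP[/andP[/eqP E1 /eqP E2]].
      have -> : t1 = Ordinal p1 by exact: val_inj.
      by have -> : t2 = Ordinal p2 by exact: val_inj.
    by exists (Ordinal p1); apply/existsP; exists (Ordinal p2); rewrite sP !eqxx.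
  rewrite /ballot; case: (e 6) e6 sE => [|[|[|[|//]]]] _ sE.
  - rewrite (sE 0 1 (ltn0Sn n) (n1)) //.
    have [[[Ka Kb] Kc] Kd] := K (Ordinal (ltn0Sn n)) (Ordinal (n1)).
    by rewrite Ka // Kd //; case: (_ && _).
  - rewrite (sE 0 1 (ltn0Sn n) (n1)) //.
    have [[[Ka Kb] Kc] Kd] := K (Ordinal (ltn0Sn n)) (Ordinal (n1)).
    by rewrite Ka // Kd //; case: (_ && _).
  - rewrite (sE 0 0 (ltn0Sn n) (ltn0Sn n)) //.
    have [[[Ka Kb] Kc] Kd] := K (Ordinal (ltn0Sn n)) (Ordinal (ltn0Sn n)).
    by rewrite Ka // Kc //; case: (_ && _).
  - rewrite (sE 1 1 (n1) (n1)) //.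
    have [[[Ka Kb] Kc] Kd] := K (Ordinal (n1)) (Ordinal (n1)).
    by rewrite Kb // Kd //; case: (_ && _).
apply/existsP/idP => [[k1 /existsP[k2 /andP[/valid_unique[km kL]]]]|b].
  by rewrite n0 /=; rewrite -(tests k1 k2 km kL).
exists (Ordinal mn); apply/existsP; exists (Ordinal Ln); rewrite x_valid n0 /=.
by rewrite -(tests (Ordinal mn) (Ordinal Ln)) // in b.
Qed.

Local Notation profile := ('I_4 * ('I_n.+1 * ('I_n.+1 * 'I_n.+1)))%type.

Definition voter_env (o : option profile) : env :=
  if o is Some (c, (d, (u, v))) then
    fun r => match r with 0 => n | 6 => c | 7 => d | 8 => u | 9 => v | _ => 0 end
  else fun _ => 0.

Definition voter_tuple (o : option profile) : nregs.-tuple 'I_n.+1 :=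
  [tuple inord (voter_env o i) | i < nregs].

(** Makes the copy numbers 0 to 3 elements of the universe, and separates ordinary voters from the
    null tuple. *)
Lemma length_ge4 : 4 <= n.
Proof. by have [nE m0] := valid_length; lia. Qed.

Lemma voter_env_bounded o : bounded n (voter_env o).
Proof.
have n4 := length_ge4; case: o => [[c [d [u v]]]|] r //=.
have := (ltn_ord c, ltn_ord d, ltn_ord u, ltn_ord v) => -[[[c4 dn] un] vn].
by do 10![case: r => [|r] /=; first lia].
Qed.

Lemma tenv_voter o r : r < nregs -> tenv (voter_tuple o) r = voter_env o r.
Proof.
move=> rK; rewrite (tenv_tnth _ (Ordinal rK)) tnth_mktuple inordK // ltnS.
exact: voter_env_bounded.
Qed.

Lemma voter_tuple_inj : injective voter_tuple.
Proof.
move=> o o' oo; have E r : r < nregs -> voter_env o r = voter_env o' r.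
  by move=> rK; rewrite -!tenv_voter // oo.
have n4 := length_ge4.
move: (E 0 isT) (E 6 isT) (E 7 isT) (E 8 isT) (E 9 isT).
case: o o' {E oo} => [[c [d [u v]]]|] [[c' [d' [u' v']]]|] //=; try lia.
by move=> _ /val_inj-> /val_inj-> /val_inj-> /val_inj->.
Qed.

Lemma voters_imset : [set t : nregs.-tuple 'I_n.+1 | voter n (tenv t)] =
  voter_tuple @: [set: option profile].
Proof.
have n4 := length_ge4; apply/setP => t; rewrite inE; apply/idP/imsetP => [vt|[o _ ->]].
  suff [o /allP oE] : exists o, all (fun r => tenv t r == voter_env o r) (iota 0 nregs).
    exists o; rewrite ?inE //; apply: eq_from_tnth => i; apply: val_inj.
    by rewrite /= -!tenv_tnth tenv_voter //; apply/eqP/oE; rewrite mem_iota ltn_ord.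
  move: vt; rewrite /voter /= => /andP[H1 /orP[/andP[/eqP t0 t6]|H2]].
    have tb r : tenv t r < n.+1 by rewrite ltnS; exact: tenv_bounded.
    have t64 : tenv t 6 < 4 by [].
    exists (Some (Ordinal t64, (Ordinal (tb 7), (Ordinal (tb 8), Ordinal (tb 9))))).
    by rewrite /= t0 !eqxx; move: H1; do ![case/andP=> ->].
  by exists None; rewrite /=; move: H1 H2; do ![case/andP=> ->].
rewrite /voter /= !tenv_voter //; case: o => [[c [d [u v]]]|] /=; last by rewrite orbT.
by rewrite eqxx /= -ltnS ltn_ord.
Qed.

Lemma card_voters : #|[set t : nregs.-tuple 'I_n.+1 | voter n (tenv t)]| =
  (4 * (n.+1 * (n.+1 * n.+1))).+1.
Proof.
rewrite voters_imset card_imset; last exact: voter_tuple_inj.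
by rewrite cardsT card_option !card_prod !card_ord.
Qed.

Lemma card_yes :
  #|[set t : nregs.-tuple 'I_n.+1 | voter n (tenv t) && vote n x R (tenv t)]| =
  (\sum_(d < n.+1) (2 * (#|A d| * #|B d|) + (n.+1 * n.+1 - #|A d| * #|A d|)
                   + (n.+1 * n.+1 - #|B d| * #|B d|))).+1.
Proof.
have n4 := length_ge4.
pose yes := [set p : profile | ballot p.1 p.2.1 p.2.2.1 p.2.2.2].
transitivity #|voter_tuple @: (None |: Some @: yes)|.
  apply: eq_card => t; rewrite inE; apply/andP/imsetP.
    case=> vt; have : t \in voter_tuple @: [set: option profile] by rewrite -voters_imset inE.
    case/imsetP=> o _ -> v; exists o => //; rewrite !inE.
    case: o v => [p v|//]; apply/orP; right; apply: imset_f; rewrite inE.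
    case: p v => c [d [u v]] /=; rewrite (@voteE _ u v) ?tenv_voter //=.
    - exact: tenv_bounded.
    - by rewrite -ltnS.
  case=> o oy ->; split.
    have : voter_tuple o \in voter_tuple @: [set: option profile] by apply: imset_f; rewrite inE.
    by rewrite -voters_imset inE.
  move: oy; rewrite !inE => /orP[/eqP->|/imsetP[[c [d [u v]]] + ->]].
    have [nE m0] := valid_length.
    have mn : m < n.+1 by lia.
    have LmL : L <= m * m * L by apply: leq_pmull; rewrite muln_gt0 m0.
    have Ln : L < n.+1 by lia.
    apply/existsP; exists (Ordinal mn); apply/existsP; exists (Ordinal Ln).
    by rewrite x_valid tenv_voter.
  rewrite inE /= (@voteE _ u v) ?tenv_voter //=.
  - exact: tenv_bounded.
  - by rewrite -ltnS.
rewrite card_imset; last exact: voter_tuple_inj.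
rewrite cardsU1 (_ : (None \in _) = false); last by apply/negP => /imsetP[].
rewrite card_imset; last by move=> ? ? [].
rewrite add1n; congr _.+1.
rewrite /yes (card_set_pair (fun (c : 'I_4) (q : 'I_n.+1 * ('I_n.+1 * 'I_n.+1)) =>
  ballot c q.1 q.2.1 q.2.2)).
under eq_bigr => c _.
  rewrite (card_set_pair (fun (d : 'I_n.+1) (q : 'I_n.+1 * 'I_n.+1) =>
    ballot c d q.1 q.2)); over.
(* The four copies contribute, for each exponent, twice the product of the counts and one complement
   of a square for each group. *)
rewrite (@big_ord_recl _ _ _ 3) (@big_ord_recl _ _ _ 2) (@big_ord_recl _ _ _ 1).
rewrite (@big_ord_recl _ _ _ 0) big_ord0 addn0 !addnA /= -!big_split /=.
apply: eq_bigr => d _; rewrite /ballot /= !card_setX_pred !card_setX_compl !card_ord.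
by rewrite addnn mul2n.
Qed.

(** Let [N = n + 1] and let [S] count the acceptances apart from the tie-breaker. By parity,
    [4 N^3 + 1 < 2 (S + 1)] means [S >= 2 N^3], while [S] never exceeds [2 N^3] and reaches it only
    if all gaps vanish. *)
Lemma majority_torsion :
  (#|[set t : nregs.-tuple 'I_n.+1 | voter n (tenv t)]| <
   2 * #|[set t : nregs.-tuple 'I_n.+1 | voter n (tenv t) && vote n x R (tenv t)]|) =
  [forall d : 'I_n.+1, #|A d| == #|B d|].
Proof.
rewrite card_voters card_yes.
have leM (Z : {set 'I_n.+1}) : #|Z| <= n.+1 by rewrite -[leqRHS]card_ord max_card.
have := @leqif_sum _ xpredT (fun d : 'I_n.+1 => #|A d| == #|B d|) _ _
  (fun d _ => square_gap (leM (A d)) (leM (B d))).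
rewrite sum_nat_const card_ord => -[le eqE].
apply/idP/forallP => [lt d|al].
  have /forallP/(_ d) // : is_true [forall (d : 'I_n.+1 | true), #|A d| == #|B d|].
  rewrite -eqE eqn_leq le /=; move: lt {le eqE}.
  by move: (\sum_(d < n.+1) _) => S; move: (n.+1 * n.+1) => W; nia.
have : \sum_(d < n.+1) (2 * (#|A d| * #|B d|) + (n.+1 * n.+1 - #|A d| * #|A d|)
                   + (n.+1 * n.+1 - #|B d| * #|B d|)) == n.+1 * (2 * (n.+1 * n.+1)).
  by rewrite eqE; apply/forallP.
by move/eqP->; move: (n.+1 * n.+1) => W; nia.
Qed.

Lemma majority_isog : #|gT| = m -> #|hT| = m ->
  abelian [set: gT] -> abelian [set: hT] ->
  (#|[set t : nregs.-tuple 'I_n.+1 | voter n (tenv t)]| <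
   2 * #|[set t : nregs.-tuple 'I_n.+1 | voter n (tenv t) && vote n x R (tenv t)]|) <->
  [set: gT] \isog [set: hT].
Proof.
move=> og oh aG aH; rewrite majority_torsion.
have cA := card_torsion m_le_n f_reads; have cB := card_torsion m_le_n g_reads.
have [nE m0] := valid_length.
split=> [/forallP al|iso]; last first.
  apply/forallP => d; have [gd|gd] := boolP (guard n d).
    by rewrite cA // cB // (isog_card_Ldiv d iso).
  have z (kT : finGroupType) (k : nat -> kT) : torsion n m k d = set0.
    by apply/setP => u; rewrite !inE (negPf gd).
  by rewrite !z !cards0.
apply: abelian_isog_Ldiv => //; first by rewrite !cardsT og oh.
rewrite cardsT og => d dm; have dn : d < n.+1 by lia.
(* For [m > 1] entries have at least one bit, so [n] exceeds [m * m] and hence the square of [d.-1];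
   for [m = 1] they have none, but then [d.-1 = 0]. *)
have gd : guard n d.
  have n4 := length_ge4; rewrite /guard (leq_trans _ n4) //=.
  have [m1|m2] := leqP m 1; first by nia.
  have L0 : 0 < L by rewrite L_len up_log_gt0.
  by nia.
by rewrite -cA // -cB //; apply/eqP; exact: (al (Ordinal dn)).
Qed.

End Vote.

Lemma card_cayley (gT : finGroupType) m (T : 'M['I_m]_m) : is_cayley_table gT T -> #|gT| = m.
Proof. by case=> e [/bij_eq_card <- _]; rewrite card_ord. Qed.

Theorem mainTheorem14 : beta1_MAC0_FOLL abelian_group_isomorphism.
Proof.
apply: (@majority_recursion (xf xdefn_power_step) (xf xdefn_vote) nregs voter).
- by [].
- exact: xf_ok.
- exact: xf_ok.
- exact: defn_voter.
- by case=> gT [hT [n [m [T [U [_ _ /(congr1 size)]]]]]]; rewrite /encode_pair size_cat /= addnS.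
move=> n x R n0 R_rec.
have R_pow e : bounded n e -> R e = power_step n x R (normal nregs e).
  by move=> be; rewrite R_rec // xfP // => r; exact: be.
have -> : [set t : nregs.-tuple 'I_n.+1 | voter n (tenv t) && xsat n x R (xf xdefn_vote) (tenv t)]
    = [set t : nregs.-tuple 'I_n.+1 | voter n (tenv t) && vote n x R (tenv t)].
  by apply/setP => t; rewrite !inE xfP //; exact: tenv_bounded.
have key (gT hT : finGroupType) m (T U : 'M['I_m]_m) :
    is_cayley_table gT T -> is_cayley_table hT U -> x = encode_pair T U :> seq bool ->
    abelian [set: gT] -> abelian [set: hT] ->
    (#|[set t : nregs.-tuple 'I_n.+1 | voter n (tenv t)]| <
     2 * #|[set t : nregs.-tuple 'I_n.+1 | voter n (tenv t) && vote n x R (tenv t)]|) <->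
    [set: gT] \isog [set: hT].
  move=> cT cU xE aG aH; have /= := valid_encode cT cU aG aH; rewrite -xE size_tuple.
  case=> xv [f [g [fr gr]]].
  exact: (majority_isog xv erefl fr gr R_pow (card_cayley cT) (card_cayley cU) aG aH).
split.
  case=> gT [hT [k [m [T [U [cT cU xE [aG aH iso]]]]]]].
  (* Tables of different orders are encodable too, but isomorphism forces the orders to agree, so
     both tables fit the single [m] of the vote. *)
  have km : k = m.
    by rewrite -(card_cayley cT) -(card_cayley cU) -!cardsT; exact: card_isog iso.
  move: T cT xE; rewrite {}km => T cT xE.
  by apply/(key gT hT m T U).
(* A strict majority includes at least one acceptance, and any acceptance certifies that [x] is a
   valid encoding, from which the groups are recovered. *)
move=> maj; have : 0 < #|[set t : nregs.-tuple 'I_n.+1 | voter n (tenv t) && vote n x R (tenv t)]|.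
  by rewrite lt0n; apply: contraTneq maj => ->; rewrite muln0.
case/card_gt0P=> t; rewrite inE => /andP[_ /existsP[m /existsP[L /andP[xv _]]]].
have [gT [hT [T [U [cT cU xE [aG aH]]]]]] := valid_decode (size_tuple x) xv.
by exists gT, hT, m, m, T, U; split=> //; split=> //; apply/(key gT hT m T U).
Qed.
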